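(* Let $k$ be a perfect field of characteristic two and let $s\in k$ be such that $x^3+sx+s$ is irreducible in $k[x]$ and the cubic extension of $k$ generated by a root of it is not cyclic. Let $\mathcal{N}=\big((k\times k\times k)\setminus\{(0,0,0)\}\big)\times(k/\mathrm{AS}(k))$, and for $(a,b,c,d)\in\mathcal{N}$ let $C^s_{abcd}$ be the smooth projective curve of genus two over $k$ with quasi-affine model $y^2+y=\frac{ax^2+bx+c}{x^3+sx+s}+d$. Then: 1. For any $(a,b,c,d),(a',b',c',d')\in\mathcal{N}$, the curves $C^s_{a'b'c'd'}$ and $C^s_{abcd}$ are $k$-isomorphic if and only if $(a',b',c',d')=(a,b,c,d)$ in $\mathcal{N}$. 2. For any $(a,b,c,d)\in\mathcal{N}$, $\mathrm{Aut}_k(C^s_{abcd})=\langle\iota\rangle$.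
   Context: $\mathrm{AS}(k)=\{x+x^2 : x\in k\}$. The fourth coordinate $d$ of an element of $\mathcal{N}$ is a class in $k/\mathrm{AS}(k)$; in the equation of the curve one uses any representative in $k$, which does not change the $k$-isomorphism class, and comparisons of fourth coordinates are in $k/\mathrm{AS}(k)$. The hyperelliptic involution is $\iota\colon(x,y)\mapsto(x,y+1)$. *)

(* Defs.v *)
From HB Require Import structures.
From mathcomp Require Import all_boot all_order all_fingroup all_algebra.
From mathcomp Require Import all_solvable all_field.
From mathcomp Require Import boolp classical_sets.
From mathcomp Require Import mpoly ring.

Set Implicit Arguments.
Unset Strict Implicit.
Unset Printing Implicit Defensive.

Import GRing.Theory.
Local Open Scope classical_set_scope.
Local Open Scope ring_scope.

Definition perfect_field (k : fieldType) : Prop :=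
  forall p : {poly k}, irreducible_poly p -> separable_poly p.

Definition cyclic_extension (k : fieldType) (L : splittingFieldType k)
    (E F : {subfield L}) : bool :=
  galois E F && cyclic 'Gal(F / E).

Definition algebraic_closure (k : fieldType) (K : closedFieldType)
    (inK : {rmorphism k -> K}) : Prop :=
  forall x : K, algebraicOver inK x.

Section ProjectiveVarieties.

(* K is meant to be an algebraic closure of k.  A point of P^n is a line of
   K^(n+1), i.e. a subspace of dimension 1; a k-variety is given by its set of
   K-points. *)
Variables (k : fieldType) (K : closedFieldType) (inK : {rmorphism k -> K}).

Definition value_at n (p : {mpoly k[n]}) (v : 'rV[K]_n) : K :=
  (map_mpoly inK p).@[v 0].

Definition values_at n m (F : 'I_m -> {mpoly k[n]}) (v : 'rV[K]_n) :
  'rV[K]_m := \row_i value_at (F i) v.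

Definition proj_zeros n (E : seq {mpoly k[n.+1]}) :
    set {vspace 'rV[K]_n.+1} :=
  [set P | \dim P = 1%N /\
           forall p v, p \in E -> v \in P -> value_at p v = 0].

(* phi is a morphism of k-varieties X -> Y: near each point of X it is given by
   forms F_0, ..., F_m over k of the same degree.  Agreement with
   [F_0 : ... : F_m] is required on the whole of X minus the common zeros of F;
   this is no restriction, since F may be multiplied by a form over k vanishing
   off a given neighbourhood. Only the values of phi on X matter. *)
Definition k_morphism n m (X : set {vspace 'rV[K]_n.+1})
    (Y : set {vspace 'rV[K]_m.+1})
    (phi : {vspace 'rV[K]_n.+1} -> {vspace 'rV[K]_m.+1}) : Prop :=
  (forall P, X P -> Y (phi P)) /\
  forall P, X P ->
    exists (e : nat) (F : 'I_m.+1 -> {mpoly k[n.+1]}),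
      [/\ forall i, F i \is e.-homog,
          forall v, v \in P -> v != 0 -> values_at F v != 0
        & forall Q v, X Q -> v \in Q -> v != 0 -> values_at F v != 0 ->
            phi Q = <[values_at F v]>%VS].

Definition k_isomorphism n m (X : set {vspace 'rV[K]_n.+1})
    (Y : set {vspace 'rV[K]_m.+1})
    (phi : {vspace 'rV[K]_n.+1} -> {vspace 'rV[K]_m.+1}) : Prop :=
  k_morphism X Y phi /\
  exists psi, [/\ k_morphism Y X psi,
                  forall P, X P -> psi (phi P) = P
                & forall Q, Y Q -> phi (psi Q) = Q].

Definition k_isomorphic n m (X : set {vspace 'rV[K]_n.+1})
    (Y : set {vspace 'rV[K]_m.+1}) : Prop :=
  exists phi, k_isomorphism X Y phi.

Definition k_automorphism n (X : set {vspace 'rV[K]_n.+1})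
    (phi : {vspace 'rV[K]_n.+1} -> {vspace 'rV[K]_n.+1}) : Prop :=
  k_isomorphism X X phi.

End ProjectiveVarieties.

Section ArtinSchreier.

Variable k : fieldType.

Definition AS : set k := [set x + x ^+ 2 | x in [set: k]].

(* k/AS(k) as the set of cosets of AS(k), each coset being a subset of k;
   a representative of D in k/AS(k) is an element of D. *)
Definition AS_quotient : set (set k) :=
  range (fun d : k => [set d + u | u in AS]).

Definition calN : set (k * k * k * set k) :=
  [set P | P.1 <> (0, 0, 0) /\ AS_quotient P.2].

End ArtinSchreier.

Definition cubic (k : fieldType) (s : k) : {poly k} :=
  'X^3 + s *: 'X + s%:P.

Section Curve.

Variables (k : fieldType) (K : closedFieldType) (inK : {rmorphism k -> K}).
Implicit Types (s a b c d : k) (x y : K).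

Definition ucoord (i : nat) : {mpoly k[5]} := 'X_(inord i).

Local Notation u0 := (ucoord 0).
Local Notation u1 := (ucoord 1).
Local Notation u2 := (ucoord 2).
Local Notation u3 := (ucoord 3).
Local Notation w := (ucoord 4).

Definition cubic_form s : {mpoly k[5]} := u0 + s *: u2 + s *: u3.

(* With h = x^3 + s x + s and Y = h y, the model becomes
   Y^2 + h Y = h (a x^2 + b x + c) + d h^2, whose smooth completion is the
   sextic Y^2 + H(X,Z) Y = H(X,Z) (a X^2 + b X Z + c Z^2) Z + d H(X,Z)^2 in the
   weighted projective plane P(1,3,1).  It is embedded in P^4 by
   (u0 : u1 : u2 : u3 : w) = (X^3 : X^2 Z : X Z^2 : Z^3 : Y), whose image is cut
   out by the cone over the twisted cubic and one more quadric.  The lemmas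
   curve_model and curve_smooth below check that this is smooth (of genus two,
   H(X,Z) having degree 3) and that the open subset u3 H <> 0 is the
   quasi-affine model. *)
Definition curve_eqs s a b c d : seq {mpoly k[5]} :=
  [:: u0 * u2 - u1 ^+ 2;
      u0 * u3 - u1 * u2;
      u1 * u3 - u2 ^+ 2;
      w ^+ 2 + cubic_form s * w
      - (cubic_form s * (a *: u1 + b *: u2 + c *: u3)
         + d *: cubic_form s ^+ 2)].

Definition curve s a b c d : set {vspace 'rV[K]_5} :=
  proj_zeros inK (curve_eqs s a b c d).

(* The involution y |-> y + 1, that is w |-> w + H; see hyperelliptic_model. *)
Definition hyperelliptic s (P : {vspace 'rV[K]_5}) : {vspace 'rV[K]_5} :=
  <[values_at inK
      (fun i : 'I_5 => [:: u0; u1; u2; u3; w + cubic_form s]`_i)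
      (vpick P)]>%VS.

Definition quasi_affine_model s a b c d : set (K * K) :=
  [set P | let: (x, y) := P in
     (map_poly inK (cubic s)).[x] != 0 /\
     y ^+ 2 + y = (inK a * x ^+ 2 + inK b * x + inK c)
                    / (map_poly inK (cubic s)).[x] + inK d].

Definition model_vect s x y : 'rV[K]_5 :=
  \row_i [:: x ^+ 3; x ^+ 2; x; 1; y * (map_poly inK (cubic s)).[x]]`_i.

Definition model_point s (P : K * K) : {vspace 'rV[K]_5} :=
  <[model_vect s P.1 P.2]>%VS.

End Curve.

Section CurveFacts.

Variables (k : fieldType) (K : closedFieldType) (inK : {rmorphism k -> K}).
Implicit Types (s a b c d : k) (x y : K).

Definition u_at (v : 'rV[K]_5) i := v 0 (inord i).
Lemma value_atX v i : value_at inK (ucoord k i) v = u_at v i.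
Proof. by rewrite /value_at map_mpolyX mevalXU. Qed.
Lemma value_atD v (p q : {mpoly k[5]}) : value_at inK (p+q) v = value_at inK p v + value_at inK q v :> K.
Proof. by rewrite /value_at raddfD /= mevalD. Qed.
Lemma value_atN v (p : {mpoly k[5]}) : value_at inK (-p) v = - value_at inK p v.
Proof. by rewrite /value_at raddfN /= mevalN. Qed.
Lemma value_atM v (p q : {mpoly k[5]}) : value_at inK (p*q) v = value_at inK p v * value_at inK q v.
Proof. by rewrite /value_at rmorphM /= mevalM. Qed.
Lemma value_atZ v e (p : {mpoly k[5]}) : value_at inK (e *: p) v = inK e * value_at inK p v.
Proof. by rewrite /value_at map_mpolyZ /= mevalZ. Qed.
Lemma value_atC v e : value_at inK (e%:MP : {mpoly k[5]}) v = inK e.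
Proof. by rewrite /value_at map_mpolyC /= mevalC. Qed.
Definition value_atE := (value_atX, value_atD, value_atN, value_atM, value_atZ, value_atC, expr2).

Definition H_at s v := u_at v 0 + inK s * u_at v 2 + inK s * u_at v 3.
Lemma value_atH s v : value_at inK (cubic_form s) v = H_at s v.
Proof. by rewrite /cubic_form !value_atE. Qed.

Lemma curve_vectP s a b c d (v : 'rV[K]_5) : v != 0 ->
  curve inK s a b c d <[v]>%VS <->
  [/\ u_at v 0 * u_at v 2 = u_at v 1 ^+ 2, u_at v 0 * u_at v 3 = u_at v 1 * u_at v 2,
      u_at v 1 * u_at v 3 = u_at v 2 ^+ 2 &
      u_at v 4 ^+ 2 + H_at s v * u_at v 4 = H_at s v * (inK a * u_at v 1 + inK b * u_at v 2 + inK c * u_at v 3)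
         + inK d * H_at s v ^+ 2].
Proof.
move=> v0; split.
  case=> _ E; have vv : v \in <[v]>%VS by rewrite memv_line.
  have E1 := E _ _ (mem_nth 0 (isT : 0 < size (curve_eqs s a b c d))%N) vv.
  have E2 := E _ _ (mem_nth 0 (isT : 1 < size (curve_eqs s a b c d))%N) vv.
  have E3 := E _ _ (mem_nth 0 (isT : 2 < size (curve_eqs s a b c d))%N) vv.
  have E4 := E _ _ (mem_nth 0 (isT : 3 < size (curve_eqs s a b c d))%N) vv.
  move: E1 E2 E3 E4; rewrite /= !(value_atE, value_atH).
  move=> /eqP; rewrite subr_eq0 => /eqP -> /eqP; rewrite subr_eq0 => /eqP ->.
  move=> /eqP; rewrite subr_eq0 => /eqP -> /eqP; rewrite subr_eq0 => /eqP e4.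
  by split; rewrite // ?expr2 e4.
case=> E1 E2 E3 E4; split; first by rewrite dim_vline v0.
have evZ l i : u_at (l *: v) i = l * u_at v i by rewrite /u_at mxE.
have HvZ l : H_at s (l *: v) = l * H_at s v by rewrite /H_at !evZ; ring.
move=> p u pE /vlineP[l ->] {u}.
move: pE; rewrite /curve_eqs !inE => /or4P[] /eqP -> {p}; rewrite !(value_atE,value_atH) !evZ ?HvZ.
- have -> : l * u_at v 0 * (l * u_at v 2) - l * u_at v 1 * (l * u_at v 1)
   = l^+2 * (u_at v 0 * u_at v 2 - u_at v 1 ^+2) by ring.
  by rewrite E1 subrr mulr0.
- have -> : l * u_at v 0 * (l * u_at v 3) - l * u_at v 1 * (l * u_at v 2)
   = l^+2 * (u_at v 0 * u_at v 3 - u_at v 1 * u_at v 2) by ring.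
  by rewrite E2 subrr mulr0.
- have -> : l * u_at v 1 * (l * u_at v 3) - l * u_at v 2 * (l * u_at v 2)
   = l^+2 * (u_at v 1 * u_at v 3 - u_at v 2 ^+ 2) by ring.
  by rewrite E3 subrr mulr0.
apply: (@eq_trans _ _ (l^+2 * ((u_at v 4 ^+ 2 + H_at s v * u_at v 4) - (H_at s v * (inK a * u_at v 1 + inK b * u_at v 2 + inK c * u_at v 3)
         + inK d * H_at s v ^+ 2)))); first by ring.
by rewrite E4 subrr mulr0.
Qed.

Definition h_at s x := (map_poly inK (cubic s)).[x].
Lemma h_atE s x : h_at s x = x ^+ 3 + inK s * x + inK s.
Proof.
by rewrite /h_at /cubic !rmorphD /= map_polyXn linearZ /= map_polyX map_polyC !hornerE.
Qed.

Lemma u_at_model s x y i : (i < 5)%N ->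
  u_at (model_vect inK s x y) i = [:: x ^+ 3; x ^+ 2; x; 1; y * h_at s x]`_i.
Proof. by move=> i5; rewrite /u_at mxE inordK. Qed.

Lemma model_vect_neq0 s x y : model_vect inK s x y != 0.
Proof.
apply: contraTneq isT => E; have := @u_at_model s x y 3 isT.
by rewrite E /u_at mxE => /esym/eqP; rewrite oner_eq0.
Qed.

Lemma H_at_model s x y : H_at s (model_vect inK s x y) = h_at s x.
Proof. by rewrite /H_at !u_at_model //= mulr1 h_atE. Qed.

Lemma u_at_inj v v' : (forall i, (i < 5)%N -> u_at v i = u_at v' i) -> v = v'.
Proof.
by move=> E; apply/rowP => i; have := E i (ltn_ord i); rewrite /u_at inord_val.
Qed.

Lemma dim1_vline (P : {vspace 'rV[K]_5}) : \dim P = 1%N ->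
  exists2 v, v != 0 & P = <[v]>%VS.
Proof.
move=> dP; have P0 : (P != 0)%VS by rewrite -dimv_eq0 dP.
exists (vpick P); first by rewrite vpick0.
apply/esym/eqP; rewrite eqEdim -memvE memv_pick /= dP dim_vline vpick0 P0 //.
Qed.

Lemma vline_eq (v v' : 'rV[K]_5) : v != 0 -> <[v]>%VS = <[v']>%VS -> exists2 l, l != 0 & v = l *: v'.
Proof.
move=> v0 E; have : v \in <[v']>%VS by rewrite -E memv_line.
case/vlineP => l e; exists l => //; apply: contraNneq v0 => l0.
by rewrite e l0 scale0r.
Qed.

Lemma curve_model_inj s : {in [pred P | h_at s P.1 != 0] &, injective (model_point inK s)}.
Proof.
move=> [x y] [x' y']; rewrite !inE /= => hx hx'.
case/(vline_eq (model_vect_neq0 s x y)) => l l0 E.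
have Ei i : u_at (model_vect inK s x y) i = l * u_at (model_vect inK s x' y') i by rewrite E /u_at mxE.
have := Ei 3; rewrite !u_at_model //= mulr1 => l1.
have := Ei 2; rewrite !u_at_model //= -l1 mul1r => ex.
have := Ei 4; rewrite !u_at_model //= -l1 mul1r ex => /(mulIf _) -> //.
Qed.

Lemma curve_model s a b c d :
  model_point inK s @` quasi_affine_model inK s a b c d =
  curve inK s a b c d `&`
    [set P : {vspace 'rV[K]_5} | forall v, v \in P -> v != 0 ->
       (value_at inK (ucoord k 3) v != 0) && (value_at inK (cubic_form s) v != 0)].
Proof.
apply/seteqP; split=> [_ [[x y] [hx e] <-] | P [CP nz]].
  split.
    apply/curve_vectP; first exact: model_vect_neq0.
    rewrite !u_at_model //= H_at_model; split; try ring.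
    rewrite -/(h_at s x) in hx e *.
    have -> : (y * h_at s x)^+2 + h_at s x * (y * h_at s x) = (y^+2 + y) * h_at s x ^+2 by ring.
    by rewrite e mulrDl expr2 mulrA mulfVK //; ring.
  move=> v /vlineP[l ->] {v} n0; have l0: l != 0 by apply: contraNneq n0 => ->; rewrite scale0r.
  rewrite value_atX value_atH /H_at /u_at !mxE !inordK //=.
  rewrite !mulr1 l0 /=.
  rewrite -/(h_at s x) in hx.
  have -> : l * x ^+ 3 + inK s * (l * x) + inK s * l = l * h_at s x by rewrite h_atE; ring.
  exact: mulf_neq0.
have [v v0 EP] := dim1_vline (proj1 CP); rewrite {}EP in CP nz *.
have /andP[] := nz v (memv_line v) v0; rewrite value_atX value_atH => n3 nH.
move/curve_vectP: CP => /(_ v0)[E1 E2 E3 E4].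
set t := (u_at v 3)^-1; set x := u_at v 2 * t; set y := u_at v 4 / H_at s v.
have e3 : u_at v 3 = t^-1 by rewrite invrK.
have t0 : t != 0 by rewrite invr_eq0.
have e2 : u_at v 2 = t^-1 * x by rewrite /x [RHS]mulrC mulfK.
have e1 : u_at v 1 = t^-1 * x^+2.
  by apply: (mulIf n3); rewrite E3 e2 e3; field.
have e0 : u_at v 0 = t^-1 * x^+3.
  by apply: (mulIf n3); rewrite E2 e2 e1 e3; field.
have eH : H_at s v = t^-1 * h_at s x by rewrite /H_at e0 e2 e3 h_atE; ring.
have hx : h_at s x != 0 by apply: contraNneq nH => h0; rewrite eH h0 mulr0.
have e4 : u_at v 4 = t^-1 * (y * h_at s x) by rewrite /y eH; field; rewrite hx t0.
exists (x, y); first split => //; rewrite -?/(h_at s x).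
  apply: (mulIf (expf_neq0 2 nH)).
  have -> : (y ^+ 2 + y) * H_at s v ^+ 2 = u_at v 4 ^+2 + H_at s v * u_at v 4.
    by rewrite e4 eH; ring.
  by rewrite E4 e1 e2 e3 eH; field; rewrite hx t0.
rewrite /model_point /=; have -> : v = t^-1 *: model_vect inK s x y.
  apply: u_at_inj => i i5; rewrite {2}/u_at mxE -/(u_at _ _) u_at_model //.
  by case: i i5 => [|[|[|[|[|]]]]] //= _; rewrite mulr1.
have tv := invr_neq0 t0.
apply/esym/eqP; rewrite eqEdim -memvE memvZ ?memv_line //= !dim_vline.
by rewrite scaler_eq0 (negbTE tv) orFb.
Qed.

Lemma hyperelliptic_model s x y :
  hyperelliptic inK s (model_point inK s (x, y)) = model_point inK s (x, y + 1).
Proof.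
rewrite /hyperelliptic; set v := vpick _.
have v0 : v != 0 by rewrite vpick0 -dimv_eq0 dim_vline model_vect_neq0.
have /vlineP[l vE] : v \in model_point inK s (x, y) by apply: memv_pick.
have l0: l != 0 by apply: contraNneq v0; rewrite vE => ->; rewrite scale0r.
have -> : values_at inK (fun i : 'I_5 => [:: ucoord k 0; ucoord k 1; ucoord k 2; ucoord k 3; ucoord k 4 + cubic_form s]`_i) v = l *: model_vect inK s x (y + 1).
  apply: u_at_inj => i i5; rewrite {2}/u_at mxE -/(u_at _ _) u_at_model // {1}/u_at mxE inordK //.
  have evl j : (j < 5)%N -> u_at v j = l * [:: x ^+ 3; x ^+ 2; x; 1; y * h_at s x]`_j.
    by move=> j5; rewrite vE -(u_at_model s x y j5) /u_at mxE.
  case: i i5 => [|[|[|[|[|]]]]] //= _; rewrite ?value_atX ?evl //.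
  by rewrite value_atD value_atX value_atH /H_at !evl //= h_atE; ring.
by apply/eqP; rewrite eqEdim -memvE memvZ ?memv_line //= !dim_vline scaler_eq0 (negbTE l0).
Qed.

(* Rank 3 = codimension of a curve in P^4 is the Jacobian criterion. *)
Definition jacobian n (E : seq {mpoly k[n]}) (v : 'rV[K]_n) : 'M[K]_(size E, n) :=
  \matrix_(i, j) value_at inK (E`_i)^`M(j) v.

Lemma rank_minor m n p (A : 'M[K]_(m, n)) (f : 'I_p -> 'I_m) (g : 'I_p -> 'I_n) :
  \det (mxsub f g A) != 0 -> (p <= \rank A)%N.
Proof.
move=> dA; have /mxrank_unit r : mxsub f g A \in unitmx by rewrite unitmxE unitfE.
have -> : p = \rank (mxsub f g A) by rewrite r.
rewrite mxsubrc (leq_trans (mxrankS (rowsub_sub _ _))) //.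
by rewrite -mxrank_tr trmx_mxsub -[leqRHS]mxrank_tr mxrankS ?rowsub_sub.
Qed.

Lemma mderiv_ucoord i j : (i < 5)%N -> (ucoord k i)^`M(j) = (i == j :> nat)%:R :> {mpoly k[5]}.
Proof.
move=> i5; rewrite /ucoord mderivX mnm1E -val_eqE /= inordK //.
case: eqP => [->|_]; last by rewrite scale0r.
rewrite inord_val scale1r; suff -> : (U_(j) - U_(j))%MM = 0%MM :> 'X_{1..5} by rewrite mpolyX0.
by apply/mnmP => l; rewrite mnmBE subnn mnm0E.
Qed.

Lemma det_mx2 (M : 'M[K]_2) : \det M = M 0 0 * M 1 1 - M 0 1 * M 1 0.
Proof.
rewrite (expand_det_row _ 0) !big_ord_recl big_ord0 /cofactor !det_mx11 !mxE /=.
rewrite expr0 expr1 addr0 mul1r mulN1r mulrN.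
by congr (M _ _ * M _ _ - M _ _ * M _ _); apply/val_inj.
Qed.

Lemma det_mx3 (M : 'M[K]_3) (i0 := inord 0 : 'I_3) (i1 := inord 1 : 'I_3) (i2 := inord 2 : 'I_3) :
  \det M =
  M i0 i0 * (M i1 i1 * M i2 i2 - M i1 i2 * M i2 i1)
 - M i0 i1 * (M i1 i0 * M i2 i2 - M i1 i2 * M i2 i0)
 + M i0 i2 * (M i1 i0 * M i2 i1 - M i1 i1 * M i2 i0).
Proof.
rewrite (expand_det_row _ i0) !big_ord_recl big_ord0 /cofactor !det_mx2 !mxE.
have E0 : ord0 = i0 by apply/val_inj; rewrite /= inordK.
have E1 : lift i0 ord0 = i1 by apply/val_inj; rewrite /= !inordK.
have E2 : lift i0 (lift ord0 ord0) = i2 by apply/val_inj; rewrite /= !inordK.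
rewrite E0 E1 E2.
have L00 : lift i0 0 = i1 by apply/val_inj; rewrite /= !inordK.
have L01 : lift i0 1 = i2 by apply/val_inj; rewrite /= !inordK.
have L10 : lift i1 0 = i0 by apply/val_inj; rewrite /= !inordK.
have L11 : lift i1 1 = i2 by apply/val_inj; rewrite /= !inordK.
have L20 : lift i2 0 = i0 by apply/val_inj; rewrite /= !inordK.
have L21 : lift i2 1 = i1 by apply/val_inj; rewrite /= !inordK.
rewrite L01 L10 L11 L20 L21 !inordK //= addr0 expr0 expr1 sqrrN expr1n.
ring.
Qed.

Lemma jacobian_minorE s a b c d v (f : 'I_3 -> 'I_4) (g : 'I_3 -> 'I_5) i j :
  mxsub f g (jacobian (curve_eqs s a b c d) v) i j =
  value_at inK ((curve_eqs s a b c d)`_(f i))^`M(g j) v.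
Proof. by rewrite !mxE. Qed.

Lemma value_at_nat v n : value_at inK (n%:R : {mpoly k[5]}) v = n%:R.
Proof. by rewrite /value_at rmorph_nat /= rmorph_nat. Qed.

Lemma curve_smooth s a b c d : 2%N \in [pchar k] ->
  irreducible_poly (cubic s) -> (a, b, c) <> (0, 0, 0) ->
  forall v, v != 0 -> curve inK s a b c d <[v]>%VS ->
  (3 <= \rank (jacobian (curve_eqs s a b c d) v))%N.
Proof.
move=> ch irr nz v v0 /(curve_vectP _ _ _ _ _ v0)[E1 E2 E3 E4].
have two0 : 2%:R = 0 :> K by rewrite -(rmorph_nat inK) (pcharf0 ch) rmorph0.
have [u30|u3n] := eqVneq (u_at v 3) 0.
  have u20 : u_at v 2 = 0 by apply/eqP; rewrite -sqrf_eq0 -E3 u30 mulr0.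
  have u10 : u_at v 1 = 0 by apply/eqP; rewrite -sqrf_eq0 -E1 u20 mulr0.
  have u0n : u_at v 0 != 0.
    apply: contraNneq v0 => u00.
    have u40 : u_at v 4 = 0.
      apply/eqP; rewrite -sqrf_eq0; move: E4.
      by rewrite /H_at u00 u20 u30 !mulr0 !addr0 mul0r addr0 => ->; rewrite mul0r expr0n mulr0 addr0.
    by apply/eqP/u_at_inj => -[|[|[|[|[|]]]]] //; rewrite {2}/u_at mxE.
  pose f (i : 'I_3) : 'I_4 := inord (nth 0 [:: 0; 1; 3] i)%N.
  pose g (i : 'I_3) : 'I_5 := inord (nth 0 [:: 2; 3; 4] i)%N.
  apply: (@rank_minor _ _ _ _ f g).
  rewrite det_mx3 !jacobian_minorE /f /g /curve_eqs /cubic_form !inordK //=.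
  rewrite !(mderivB, mderivD, mderivM, mderivZ, mderiv_ucoord, expr2) // !inordK //=.
  rewrite !(value_atE, value_at_nat) u10 u20 u30.
  rewrite [X in X != 0](_ : _ = u_at v 0 ^+ 2 * (2%:R * u_at v 4 + u_at v 0)); last by ring.
  by rewrite two0 mul0r add0r mulf_neq0 ?expf_neq0.
pose f (i : 'I_3) : 'I_4 := inord (nth 0 [:: 1; 2; 3] i)%N.
have [H0|Hn] := eqVneq (H_at s v) 0; last first.
  pose g (i : 'I_3) : 'I_5 := inord (nth 0 [:: 0; 1; 4] i)%N.
  apply: (@rank_minor _ _ _ _ f g).
  rewrite det_mx3 !jacobian_minorE /f /g /curve_eqs /cubic_form !inordK //=.
  rewrite !(mderivB, mderivD, mderivM, mderivZ, mderiv_ucoord, expr2) // !inordK //=.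
  rewrite !(value_atE, value_at_nat).
  rewrite [X in X != 0](_ : _ = u_at v 3 ^+ 2 * (2%:R * u_at v 4 + H_at s v)).
    by rewrite two0 mul0r add0r mulf_neq0 ?expf_neq0.
  by rewrite /H_at; ring.
have u40 : u_at v 4 = 0.
  by apply/eqP; rewrite -sqrf_eq0; move: E4; rewrite H0 !mul0r addr0 => ->; rewrite expr0n mulr0 addr0.
pose g (i : 'I_3) : 'I_5 := inord (nth 0 [:: 0; 1; 2] i)%N.
apply: (@rank_minor _ _ _ _ f g).
rewrite det_mx3 !jacobian_minorE /f /g /curve_eqs /cubic_form !inordK //=.
rewrite !(mderivB, mderivD, mderivM, mderivZ, mderiv_ucoord, expr2) // !inordK //=.
rewrite !(value_atE, value_at_nat) u40.
pose N := inK a * u_at v 1 + inK b * u_at v 2 + inK c * u_at v 3.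
have u00 : u_at v 0 = - (inK s * u_at v 2 + inK s * u_at v 3).
  by apply/eqP; rewrite -subr_eq0 opprK addrA; apply/eqP.
rewrite [X in X != 0](_ : _ = - N * (inK s * u_at v 3 ^+ 2 + u_at v 1 * u_at v 3
    + 2%:R * u_at v 2 ^+ 2)); last by rewrite /N u00; ring.
rewrite two0 mul0r addr0 E3.
have [x e2] : exists x, u_at v 2 = x * u_at v 3 by exists (u_at v 2 / u_at v 3); rewrite mulfVK.
have e1 : u_at v 1 = x ^+ 2 * u_at v 3 by apply: (mulIf u3n); rewrite E3 e2; ring.
have e0 : u_at v 0 = x ^+ 3 * u_at v 3 by apply: (mulIf u3n); rewrite E2 e2 e1; ring.
have hx : h_at s x = 0.
  by apply: (mulIf u3n); rewrite mul0r -H0 /H_at e0 e2 h_atE; ring.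
have cub3 : size (cubic s) = 4.
  rewrite /cubic -addrA size_polyDl size_polyXn // (leq_ltn_trans (size_polyD _ _)) //.
  by rewrite gtn_max (leq_ltn_trans (size_scale_leq _ _)) ?size_polyX // (leq_ltn_trans (size_polyC_leq1 _)).
rewrite mulf_neq0 ?oppr_eq0 //.
  pose p : {poly k} := a *: 'X^2 + b *: 'X + c%:P.
  have sp : (size p <= 3)%N.
    rewrite (leq_trans (size_polyD _ _)) // geq_max (leq_trans (size_polyC_leq1 _)) // andbT.
    rewrite (leq_trans (size_polyD _ _)) // geq_max !(leq_trans (size_scale_leq _ _)) ?size_polyX //.
    by rewrite size_polyXn.
  have p0 : p != 0.
    apply: contra_notN nz => /eqP E.
    have Ei i : p`_i = 0 by rewrite E coef0.
    move: (Ei 0%N) (Ei 1%N) (Ei 2%N).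
    rewrite /p !(coefD, coefZ, coefXn, coefX, coefC) /= !(mulr0, mulr1, addr0, add0r).
    by move=> -> -> ->.
  apply: contraTneq isT => N0; exfalso.
  have px : root (map_poly inK p) x.
    rewrite /p !rmorphD /= !linearZ /= map_polyXn map_polyX map_polyC /root !(hornerD, hornerZ, hornerXn, hornerX, hornerC).
    by apply/eqP; apply: (mulIf u3n); rewrite mul0r -N0 /N e1 e2; ring.
  have gx : root (map_poly inK (gcdp (cubic s) p)) x.
    by rewrite gcdp_map root_gcd px /root -/(h_at s x) hx eqxx.
  have [_ /(_ (gcdp (cubic s) p))] := irr.
  move=> /(_ _ (dvdp_gcdl _ _)) irr'.
  have sg : size (gcdp (cubic s) p) != 1%N.
    apply: contraTneq gx => /eqP/size_poly1P[e e0' ->].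
    by rewrite map_polyC rootC fmorph_eq0.
  have /eqp_size E := irr' sg.
  have := dvdp_leq p0 (dvdp_gcdr (cubic s) p); rewrite E cub3 => /leq_trans/(_ sp).
  by [].
rewrite e2 (_ : _ + _ = (inK s + x^+2) * u_at v 3 ^+2); last by ring.
rewrite mulf_neq0 ?expf_neq0 //.
apply: contraTneq isT => sx; exfalso.
have s0 : inK s = 0.
  have e : h_at s x = x * (inK s + x ^+ 2) + inK s by rewrite h_atE; ring.
  by rewrite -hx e sx mulr0 add0r.
have {}s0 : s = 0 by apply/eqP; rewrite -(fmorph_eq0 inK) s0.
have [_ /(_ 'X)] := irr; rewrite size_polyX => /(_ isT).
have -> : 'X %| cubic s by rewrite /cubic s0 scale0r !addr0 exprS dvdp_mulr.
by move=> /(_ isT) /eqp_size; rewrite size_polyX cub3.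
Qed.

End CurveFacts.

(* Main.v *)
Require Import Defs.
From HB Require Import structures.
From mathcomp Require Import all_boot all_order all_fingroup all_algebra.
From mathcomp Require Import all_solvable all_field.
From mathcomp Require Import boolp classical_sets.
From mathcomp Require Import mpoly ring.

Set Implicit Arguments.
Unset Strict Implicit.
Unset Printing Implicit Defensive.

Import GRing.Theory.
Local Open Scope classical_set_scope.
Local Open Scope ring_scope.

(* Let h = x^3 + s x + s, let m = a x^2 + b x + c + d h, and let m' be the same
   for the source curve; their equations are h (y^2 + y) = m, m'.  An isomorphism
   gives G, W in E = k(x)(y), the coordinates of the image of the generic point,
   and its inverse shows that x and y are linear in W over k(G).
   - Elimination of W shows that x is quadratic over k[G].  If G is not in k(x),
     let p2 T^2 + p1 T + p0 be its primitive equation over k[x]; by Gauss's lemma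
     the p_i have degree at most 2 in x.  Writing G = A + (p1/p2) y and comparing
     poles at h, which are of odd order in p1^2 m'/h only, gives h | p1, so
     p1 = 0: a contradiction.
   - Hence G is in k(x) and, by Gauss's lemma again, of degree one.  Then W = y + P
     with P in k(x), and P^2 + P is the difference of the two right-hand sides:
     comparing poles, the Moebius transformation G permutes the roots of h.  It is
     the identity, since otherwise a root of h would generate a Galois, hence
     cyclic, cubic extension.
   - Comparing the right-hand sides once more shows that m = m' up to
     (u + u^2) h, and the isomorphism is y |-> y + u. *)

(** * Reduced fractions and Gauss's lemma *)

Lemma frac_coprime (F : fieldType) (P : {fraction {poly F}}) :
  exists u w : {poly F},
    [/\ w != 0, coprimep u w & P = FracField.tofrac u / FracField.tofrac w].
Proof.
elim/quotW: P => r; have d0 := denom_ratioP r.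
have dg := divpK (dvdp_gcdr (frac r).1 (frac r).2).
have ng := divpK (dvdp_gcdl (frac r).1 (frac r).2).
set g := gcdp _ _ in dg ng; have g0 : g != 0 by rewrite gcdp_eq0 negb_and d0 orbT.
exists ((frac r).1 %/ g), ((frac r).2 %/ g); split.
- by apply: contraNneq d0 => E; rewrite -dg E mul0r.
- by apply: coprimep_div_gcd; rewrite d0 orbT.
have w0 : (frac r).2 %/ g != 0 by apply: contraNneq d0 => E; rewrite -dg E mul0r.
have gF : FracField.tofrac g != 0 by rewrite tofrac_eq0.
have wF : FracField.tofrac ((frac r).2 %/ g) != 0 by rewrite tofrac_eq0.
apply: (mulIf wF); rewrite mulfVK //; apply: (mulIf gF).
rewrite -[RHS]tofracM ng -mulrA -[X in _ * X]tofracM dg.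
unlock FracField.tofrac; rewrite -[LHS]FracField.pi_mul /FracField.mulf.
rewrite -[in LHS](Ratio_numden r) !numden_Ratio ?oner_eq0 ?mulf_neq0 // !mulr1.
apply/eqmodP; rewrite /= FracField.equivfE !numden_Ratio ?oner_eq0 ?mulf_neq0 //.
by rewrite mulr1 mulrC.
Qed.

Section Gauss.
Variable K : closedFieldType.

(* The first hypothesis says that [p] is primitive over [K[x]], [x] being the inner variable. *)
Lemma sizeY_dvd_primitive (p q r : {poly {poly K}}) (c : {poly K}) :
  (forall t : K, map_poly (horner_eval t) p != 0) -> c != 0 -> q != 0 ->
  c *: q = p * r -> (sizeY p <= sizeY q)%N.
Proof.
move=> prim; have [n] := ubnP (size c).
elim: n c r => // n IH c r; rewrite ltnS => sc c0 q0 E.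
have p0 : p != 0 by apply: contraTneq (prim 0) => ->; rewrite rmorph0 eqxx.
have r0 : r != 0.
  apply: contraNneq q0 => r0; move/eqP: E; rewrite r0 mulr0 scale_poly_eq0.
  by rewrite (negbTE c0).
have [/size_poly1P[e e0 ce]|/closed_rootP[t ct]] := boolP (size c == 1%N).
  have -> : sizeY q = sizeY (c *: q).
    rewrite !sizeYE ce -mul_polyC rmorphM /= swapXY_polyC map_polyC /= mul_polyC.
    by rewrite size_scale ?polyC_eq0.
  rewrite E !sizeYE rmorphM /= size_mul ?swapXY_eq0 //.
  by rewrite -subn1 -addnBA ?leq_addr // lt0n size_poly_eq0 swapXY_eq0.
have [c' Ec] := factor_theorem _ _ ct.
have c'0 : c' != 0 by apply: contraNneq c0 => c'0; rewrite Ec c'0 mul0r.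
(* At a root t of [c] the product [p * r] vanishes but [p] does not, so x - t divides every
   coefficient of [r] and cancels from both sides. *)
have rt : map_poly (horner_eval t) r = 0.
  apply/eqP; have := congr1 (map_poly (horner_eval t)) E.
  rewrite -mul_polyC !rmorphM /= map_polyC /= {1}/horner_eval (rootP ct) mul0r.
  by move/esym/eqP; rewrite mulf_eq0 (negbTE (prim t)).
have [r' Er] : exists r', r = ('X - t%:P) *: r'.
  exists (map_poly (fun f => f %/ ('X - t%:P)) r); apply/polyP=> i.
  rewrite coefZ coef_map_id0 ?div0p // mulrC divpK // dvdp_XsubCl; apply/rootP.
  by have := congr1 (fun g : {poly K} => g`_i) rt; rewrite coef_map coef0.
apply: (IH c' r') => //.
  by move: sc; rewrite Ec size_Mmonic ?monicXsubC // size_XsubC addn2 /=.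
have X0 : ('X - t%:P : {poly K})%:P != 0 by rewrite polyC_eq0 polyXsubC_eq0.
apply: (mulfI X0); move: E; rewrite Ec Er mulrC -scalerA -!mul_polyC => ->.
by rewrite mulrCA.
Qed.
End Gauss.

(** * Poles of rational functions *)

Section PolyFacts.
Variable k : fieldType.
Implicit Types (h p q u w g : {poly k}).

Lemma irreducible_dvdM h p q :
  irreducible_poly h -> h %| p * q -> (h %| p) || (h %| q).
Proof.
move=> irr hpq; case: (boolP (h %| p)) => //= hp.
by rewrite -(Gauss_dvdpr q (_ : coprimep h p)) // irreducible_poly_coprime.
Qed.

Lemma irreducible_dvdX h p n :
  irreducible_poly h -> h %| p ^+ n -> h %| p.
Proof.
move=> irr; elim: n => [|n IH].
  rewrite expr0 dvdp1 => /eqP h1; case: irr; rewrite h1 //.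
by rewrite exprS => /(irreducible_dvdM irr)/orP[].
Qed.

(* [F] stands for [{fraction {poly k}}], which is kept abstract because [ring] and
   [field] do not terminate on the concrete construction. *)
Variables (F : fieldType) (toF : {rmorphism {poly k} -> F}).
Hypothesis toF_inj : injective toF.
Hypothesis toF_frac : forall P, exists u w,
  [/\ w != 0, coprimep u w & P = toF u / toF w].
Local Notation "x %:F" := (toF x).

Lemma toF_eq0 p : (p%:F == 0) = (p == 0).
Proof. by rewrite -(inj_eq toF_inj) rmorph0. Qed.

(* If [h] divides the denominator of [P], it divides that of [P ^+ 2 + c P] to an
   even order, while a simple pole at [h] would occur if [h] did not divide [g]. *)
Lemma simple_pole_absurd h h1 c g P :
  irreducible_poly h -> ~~ (h %| h1) ->
  (h * h1)%:F * (P ^+ 2 + c%:F * P) = g%:F -> h %| g.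
Proof.
move=> irr nh1; have [u [w [w0 cuw ->]]] := toF_frac P.
have wF : w%:F != 0 by rewrite toF_eq0.
move=> E.
have {}E : h * (h1 * (u ^+ 2 + c * u * w)) = w ^+ 2 * g.
  apply: toF_inj; rewrite [RHS]rmorphM -E !(rmorphM, rmorphD, rmorphXn).
  by field.
have hg : h %| w ^+ 2 * g by rewrite -E dvdp_mulr.
have [//|hg'] := boolP (h %| g).
  have := irreducible_dvdM irr hg; rewrite (negbTE hg') orbF.
  move=> /(irreducible_dvdX irr) hw; exfalso.
  have /dvdpP[w2 Ew] := hw.
  have h0 : h != 0 by apply: contraNneq w0 => h0; rewrite Ew h0 mulr0.
  (* The denominator enters squared, so a factor h is left over after cancelling one; it forces h to
     divide u, against [cuw]. *)
  have : h %| h1 * (u ^+ 2 + c * u * w).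
    have -> : h1 * (u ^+ 2 + c * u * w) = h * (w2 ^+ 2 * g).
      by apply: (mulfI h0); rewrite E Ew; ring.
    exact: dvdp_mulr.
  move=> /(irreducible_dvdM irr); rewrite (negbTE nh1) /= dvdp_addl; last first.
    by rewrite dvdp_mull.
  move=> /(irreducible_dvdX irr) hu.
  have := irr.1; have : h %| gcdp u w by rewrite dvdp_gcd hu hw.
  move/eqP: cuw => cuw /dvdp_leq; rewrite -size_poly_eq0 cuw => /(_ isT).
  by case: (size h) => [|[]].
Qed.

(** Multiplication by p2 turns T^2 + P T + Q into a primitive polynomial over k[x], as Gauss's lemma
    requires. *)
Lemma frac2_coprime P Q : exists p0 p1 p2 : {poly k},
  [/\ p2 != 0, coprimep (gcdp p2 p1) p0, p2%:F * P = p1%:F & p2%:F * Q = p0%:F].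
Proof.
have [b [e [e0 _ EP]]] := toF_frac P.
have [n [f [f0 _ EQ]]] := toF_frac Q.
have eF : e%:F != 0 by rewrite toF_eq0.
have fF : f%:F != 0 by rewrite toF_eq0.
have ef0 : e * f != 0 by rewrite mulf_neq0.
set g := gcdp (gcdp (e * f) (b * f)) (n * e).
have g0 : g != 0 by rewrite !gcdp_eq0 !negb_and ef0.
have gF : g%:F != 0 by rewrite toF_eq0.
have g2 : g %| e * f by rewrite (dvdp_trans (dvdp_gcdl _ _)) ?dvdp_gcdl.
have g1 : g %| b * f by rewrite (dvdp_trans (dvdp_gcdl _ _)) ?dvdp_gcdr.
have gn : g %| n * e by apply: dvdp_gcdr.
exists (n * e %/ g), (b * f %/ g), (e * f %/ g).
have D p : g %| p -> (p %/ g)%:F = p%:F / g%:F.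
  by move=> gp; apply: (mulIf gF); rewrite mulfVK // -rmorphM divpK.
split.
- by apply: contraNneq ef0 => E; rewrite -(divpK g2) E mul0r.
- have gg : gcdp (e * f %/ g) (b * f %/ g) %= gcdp (e * f) (b * f) %/ g.
    rewrite -(eqp_mul2r _ _ g0) divpK ?dvdp_gcdl //.
    by rewrite (eqp_trans (mulp_gcdl _ _ _)) // !divpK ?eqpxx.
  rewrite (eqp_coprimepl _ gg).
  by apply: coprimep_div_gcd; rewrite gcdp_eq0 negb_and ef0.
- by rewrite !D // EP !rmorphM /=; field; rewrite gF eF.
- by rewrite !D // EQ !rmorphM /=; field; rewrite gF fF.
Qed.

End PolyFacts.

(** * The function field of the curve *)

(** The binary cubic form w^3 p(u/w), for p of degree at most three. *)
Definition hom3 (k : fieldType) (p u w : {poly k}) : {poly k} :=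
  (p`_0)%:P * w ^+ 3 + (p`_1)%:P * (u * w ^+ 2) + (p`_2)%:P * (u ^+ 2 * w)
  + (p`_3)%:P * u ^+ 3.

Lemma hom3E (k : fieldType) (E : fieldType) (f : {rmorphism {poly k} -> E})
    (p u w : {poly k}) (G : E) : (size p <= 4)%N -> G * f w = f u ->
  f (hom3 p u w) = (map_poly (f \o polyC) p).[G] * f w ^+ 3.
Proof.
move=> sp fuw; rewrite (@horner_coef_wide _ 4); last first.
  by rewrite (leq_trans (size_poly _ _)).
rewrite !big_ord_recr big_ord0 /= !coef_map /=.
by rewrite /hom3 !(rmorphD, rmorphM, rmorphXn) -fuw; ring.
Qed.

Section GenericPoint.
Variables (k : fieldType) (K : closedFieldType) (inK : {rmorphism k -> K}).
Variables (F : fieldType) (toF : {rmorphism {poly k} -> F}).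
Hypothesis toF_inj : injective toF.
Hypothesis toF_frac : forall P, exists u w,
  [/\ w != 0, coprimep u w & P = toF u / toF w].
Variables (E : fieldType) (inE : {rmorphism F -> E}).
Local Notation ev := (inE \o toF).
Local Notation evC := (inE \o toF \o polyC).
Implicit Types (p q u w g : {poly k}).

Lemma ev_eq0 p : (ev p == 0) = (p == 0).
Proof. by rewrite /= fmorph_eq0 toF_eq0. Qed.

Lemma ev_X p : (map_poly evC p).[ev 'X] = ev p.
Proof. by rewrite map_poly_comp horner_map -/(p \Po 'X) comp_polyXr. Qed.

Lemma ev_map_polyC p (G : E) : (map_poly ev (map_poly polyC p)).[G] = (map_poly evC p).[G].
Proof. by rewrite -map_poly_comp. Qed.

(** Substitutes G for the inner variable and x for the outer one; it evaluates equations of x over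
    k[G]. *)
Definition swap_ev (G : E) : {poly {poly k}} -> E :=
  horner_eval G \o map_poly ev \o swapXY.
HB.instance Definition _ G := GRing.RMorphism.on (swap_ev G).

Lemma swap_evC G p : swap_ev G p%:P = (map_poly evC p).[G].
Proof. by rewrite /swap_ev /= /horner_eval swapXY_polyC ev_map_polyC. Qed.

Lemma swap_evX G : swap_ev G 'X = ev 'X.
Proof. by rewrite /swap_ev /= /horner_eval swapXY_X map_polyC hornerC. Qed.

(** Pseudo-division by [p] leaves a remainder that vanishes at G, hence is zero; thus [p] divides a
    k[x]-multiple of [q], and Gauss's lemma compares the degrees in x. Primitivity is tested at the
    points of K: the coefficients of [p] have no common root. *)
Lemma sizeY_minimal (p q : {poly {poly k}}) (G : E) :
  (forall t : K, map_poly (horner_eval t \o map_poly inK) p != 0) -> q != 0 ->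
  (map_poly ev q).[G] = 0 -> (map_poly ev p).[G] = 0 ->
  (forall r : {poly {poly k}}, (size r < size p)%N -> (map_poly ev r).[G] = 0 -> r = 0) ->
  (sizeY p <= sizeY q)%N.
Proof.
move=> prim q0 qG pG pmin.
have p0 : p != 0 by apply: contraTneq (prim 0) => ->; rewrite rmorph0 eqxx.
have := Pdiv.Idomain.divp_eq q p; set c := _ ^+ _; set r := q %% p => D.
have c0 : c != 0 by rewrite expf_neq0 // lead_coef_eq0.
have r0 : r = 0.
  apply: pmin; first by rewrite Pdiv.Idomain.ltn_modp.
  have := congr1 (fun f => (map_poly ev f).[G]) D.
  rewrite -mul_polyC !(rmorphM, rmorphD) /= !(hornerM, hornerD) qG pG.
  by rewrite !mulr0 add0r => /esym.
have szY (f : {poly {poly k}}) : sizeY (map_poly (map_poly inK) f) = sizeY f.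
  by rewrite !sizeYE swapXY_map size_map_inj_poly ?rmorph0 //; apply: map_poly_inj.
rewrite -(szY p) -(szY q).
apply: (@sizeY_dvd_primitive K _ _ (map_poly (map_poly inK) (q %/ p)) (map_poly inK c)).
- by move=> t; rewrite -map_poly_comp; apply: prim.
- by rewrite map_poly_eq0.
- by rewrite -size_poly_eq0 size_map_inj_poly ?rmorph0 ?size_poly_eq0 //; apply: map_poly_inj.
- move: D; rewrite r0 addr0 => /(congr1 (map_poly (map_poly inK))).
  by rewrite -mul_polyC !rmorphM /= map_polyC /= mul_polyC mulrC.
Qed.

Variables (h m m' : {poly k}) (y : E).
Hypothesis irr : irreducible_poly h.
Hypothesis hsz : size h = 4.
Hypothesis char2 : 2%N \in [pchar E].
Hypothesis nhm : ~~ (h %| m).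
Hypothesis nhm' : ~~ (h %| m').
Hypothesis Ey : ev h * (y ^+ 2 + y) = ev m'.
Hypothesis basis : forall e : E, exists A B : F, e = inE A + inE B * y.

Lemma two0 : 2%:R = 0 :> E. Proof. exact: pcharf0 char2. Qed.

Lemma h_neq0 : h != 0. Proof. exact: irredp_neq0. Qed.

Lemma h_ndvd1 : ~~ (h %| 1).
Proof. by rewrite dvdp1; case: irr; case: (size h) => [|[]]. Qed.

(** Brings characteristic two within the reach of [ring]: [c] is half of the difference of the two
    sides. *)
Lemma addE2 (a b c : E) : a = b + 2%:R * c -> a = b.
Proof. by rewrite two0 mul0r addr0. Qed.

(** Poles of P^2 + P have even order, while l/h has a simple pole at h. *)
Lemma AS_noroot (l : {poly k}) (P : F) : ~~ (h %| l) -> toF h * (P ^+ 2 + P) <> toF l.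
Proof.
move=> nhl EP; move/negP: nhl; apply.
apply: (simple_pole_absurd toF_inj toF_frac irr h_ndvd1 (c := 1) (P := P)).
by rewrite mulr1 rmorph1 mul1r.
Qed.

(** If B were nonzero, y would lie in k(x) and solve the Artin-Schreier equation for m'/h. *)
Lemma basis_eq0 (A B : F) : inE A + inE B * y = 0 -> A = 0 /\ B = 0.
Proof.
move=> AB0; have [B0|B0] := eqVneq B 0.
  by move/eqP: AB0; rewrite B0 rmorph0 mul0r addr0 fmorph_eq0 => /eqP.
have BE : inE B != 0 by rewrite fmorph_eq0.
have yE : y = inE (- A / B).
  apply: (mulIf BE); rewrite fmorph_div rmorphN mulfVK //.
  by apply/eqP; rewrite -addr_eq0 addrC mulrC AB0.
exfalso; apply: (AS_noroot (P := - A / B) nhm'); apply: (fmorph_inj inE).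
have /= <- := Ey; rewrite [in RHS]yE.
by rewrite !(rmorphM inE, rmorphD inE, rmorphXn inE).
Qed.

Lemma y_irrational (A : F) : y <> inE A.
Proof.
move=> yA; have := @basis_eq0 (- A) 1.
by rewrite rmorphN rmorph1 mul1r yA addNr => /(_ erefl)[_ /eqP]; rewrite oner_eq0.
Qed.

Variables (G W : E).
Hypothesis hG : (map_poly evC h).[G] != 0.
Hypothesis EW : (map_poly evC h).[G] * (W ^+ 2 + W) = (map_poly evC m).[G].
(** Up to a common factor, [a_i + b_i W] over k[G] is the coordinate of index i of the inverse at
    (G, W); the indices 3, 2, 4 belong to 1, x and h y. *)
Variables (a3 b3 a2 b2 a4 b4 : {poly k}).
Local Notation at_ p := (map_poly evC p).[G].
Hypothesis mu0 : at_ a3 + at_ b3 * W != 0.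
Hypothesis Ex : (at_ a3 + at_ b3 * W) * ev 'X = at_ a2 + at_ b2 * W.
Hypothesis EY : (at_ a3 + at_ b3 * W) * (ev h * y) = at_ a4 + at_ b4 * W.

Lemma at_rational (A : F) (p : {poly k}) : G = inE A -> exists B, at_ p = inE B.
Proof.
move=> ->; exists (map_poly (toF \o polyC) p).[A].
by rewrite -horner_map -map_poly_comp.
Qed.

Lemma G_rational : exists A, G = inE A.
Proof.
have [A [B EG]] := basis G.
have [B0|B0] := eqVneq B 0; first by exists A; rewrite EG B0 rmorph0 mul0r addr0.
(* B and N are the trace and the norm of G over k(x); the conjugate of y is y + 1. *)
pose N := A ^+ 2 + A * B + B ^+ 2 * (toF m' / toF h).
have hF : toF h != 0 by rewrite toF_eq0 // h_neq0.
have hE : inE (toF h) != 0 by rewrite fmorph_eq0.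
have yy : y ^+ 2 + y = inE (toF m' / toF h).
  by apply: (mulfI hE); rewrite Ey /= fmorph_div /= mulrCA mulfV ?mulr1.
have GN : G ^+ 2 + inE B * G + inE N = 0.
  apply: (addE2 (c := inE A ^+ 2 + inE A * inE B + inE B ^+ 2 * (y ^+2 + y) + inE A * inE B * y)).
  rewrite /N; move: (_ / _) yy => f0 yy.
  by rewrite !(rmorphD inE, rmorphXn inE, rmorphM inE) -yy EG; ring.
have [p0 [p1 [p2 [p20 cop EB EN]]]] := frac2_coprime toF_inj toF_frac B N.
pose p : {poly {poly k}} := p2%:P * 'X^2 + p1%:P * 'X + p0%:P.
have sp : size p = 3.
  rewrite /p -addrA size_polyDl size_Cmul ?size_polyXn //.
  rewrite (leq_ltn_trans (size_polyD _ _)) // gtn_max.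
  rewrite (leq_ltn_trans (size_polyC_leq1 _)) // andbT.
  by rewrite mul_polyC (leq_ltn_trans (size_scale_leq _ _)) // size_polyX.
have evp : (map_poly ev p).[G] = 0.
  rewrite /p !(rmorphD, rmorphXn, rmorphM) /= !map_polyC !map_polyX.
  rewrite !(hornerD, hornerCM, hornerXn, hornerC, hornerX) /=.
  rewrite -[toF p1]EB -[toF p0]EN !(rmorphM inE).
  rewrite -[RHS](mulr0 (inE (toF p2))) -GN.
  by ring.
(* The coefficient of x^2 in the equation [sq] below; if it vanished, either a3 = b3 = 0 or a3/b3
   would solve the Artin-Schreier equation for m/h. *)
pose c2 := h * (a3 ^+ 2 + a3 * b3) - b3 ^+ 2 * m.
have c20 : c2 != 0.
  rewrite subr_eq0; apply/eqP => Ec.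
  have [b0|b0] := eqVneq b3 0.
    move: Ec; rewrite b0 mulr0 addr0 expr0n mul0r => /eqP.
    rewrite mulf_eq0 (negbTE h_neq0) sqrf_eq0 /= => /eqP a0.
    by move: mu0; rewrite a0 b0 rmorph0 horner0 mul0r addr0 eqxx.
  apply: (AS_noroot (P := toF a3 / toF b3) nhm).
  have bF : toF b3 != 0 by rewrite toF_eq0.
  have EcF := congr1 toF Ec; rewrite !(rmorphM, rmorphD, rmorphXn) in EcF.
  by apply: (mulIf (expf_neq0 2 bF)); rewrite [RHS]mulrC -EcF; field.
(* Elimination of W from [EW] and [Ex], with G as inner and x as outer variable. *)
pose sq : {poly {poly k}} :=
  h%:P * ((a3%:P * 'X - a2%:P) ^+ 2 + (a3%:P * 'X - a2%:P) * (b3%:P * 'X - b2%:P))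
  - (b3%:P * 'X - b2%:P) ^+ 2 * m%:P.
have sqE : exists c1 c0, sq = c2%:P * 'X^2 + c1%:P * 'X + c0%:P.
  exists (- h * (2%:R * (a3 * a2) + a3 * b2 + a2 * b3) + 2%:R * b3 * b2 * m).
  exists (h * (a2 ^+ 2 + a2 * b2) - b2 ^+ 2 * m).
  by rewrite /sq /c2; ring.
have sq0 : sq != 0.
  have [c1 [c0 ->]] := sqE; apply: contraNneq c20 => /(congr1 (fun f : {poly {poly k}} => f`_2)).
  by rewrite !(coefD, coefCM, coefXn, coefX, coefC, coef0) /= mulr0 mulr1 !addr0 => ->.
have ssq : (size sq <= 3)%N.
  have [c1 [c0 ->]] := sqE; apply/leq_sizeP => i i3.
  rewrite !(coefD, coefCM, coefXn, coefX, coefC).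
  by case: i i3 => [|[|[|i]]] //= _; rewrite !mulr0 !addr0.
have evq : (map_poly ev (swapXY sq)).[G] = 0.
  have fsq (f : {rmorphism {poly {poly k}} -> E}) : f sq =
      f h%:P * ((f a3%:P * f 'X - f a2%:P) ^+ 2
        + (f a3%:P * f 'X - f a2%:P) * (f b3%:P * f 'X - f b2%:P))
      - (f b3%:P * f 'X - f b2%:P) ^+ 2 * f m%:P.
    by rewrite /sq; ring.
  apply: etrans (fsq (swap_ev G)) _; rewrite /= !swap_evC swap_evX /=.
  set X := inE (toF 'X); set a := _ * X - _; set b := at_ b3 * X - _.
  have ab : a = b * W.
    apply: (addE2 (c := - b * W)).
    have : a + b * W = 0.
      apply/eqP; rewrite -subr_eq0 subr0; apply/eqP.
      rewrite -(subrr ((at_ a3 + at_ b3 * W) * ev 'X)) {2}Ex /a /b /X /=; ring.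
    by move/eqP; rewrite addr_eq0 => /eqP ->; ring.
  rewrite ab.
  have -> : (b * W) ^+ 2 + b * W * b = b ^+ 2 * (W ^+ 2 + W) by ring.
  by rewrite mulrCA EW; ring.
(* After the swap, the degree two of [sq] in x bounds the degree in x of the primitive minimal
   equation [p] of G. *)
have sYp : (sizeY p <= 3)%N.
  apply: leq_trans ssq; rewrite -[sq]swapXYK -sizeYE.
  apply: sizeY_minimal evq evp _ => [t||r].
  - apply: contraTneq isT => pt; exfalso.
    have ci (i : 'I_3) : root (map_poly inK p`_i) t.
      have := congr1 (fun f : {poly K} => f`_i) pt.
      by rewrite coef_map coef0 => /eqP.
    have := ci (Ordinal (isT : 0 < 3)%N); have := ci (Ordinal (isT : 1 < 3)%N).
    have := ci (Ordinal (isT : 2 < 3)%N).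
    rewrite /p !(coefD, coefCM, coefXn, coefX, coefC) /= !mulr0 !mulr1 !addr0 !add0r.
    move=> r2 r1 r0; have : root (map_poly inK (gcdp (gcdp p2 p1) p0)) t.
      by rewrite !gcdp_map !root_gcd r2 r1 r0.
    have /size_poly1P[e e0 ->] := cop.
    by rewrite map_polyC rootC fmorph_eq0 (negbTE e0).
  - by rewrite swapXY_eq0.
  (* A linear equation r1 G + r0 = 0 would have r1 B as coefficient of y, and B is nonzero. *)
  rewrite sp => sr rG.
  have Er : r = (r`_1)%:P * 'X + (r`_0)%:P.
    apply/polyP => i; rewrite coefD coefCM coefX coefC.
    case: i => [|[|i]] /=; rewrite ?(mulr0, mulr1, add0r, addr0) //.
    by rewrite nth_default // (leq_trans _ (_ : 2 <= _)%N).
  move: rG; rewrite Er rmorphD rmorphM /= !map_polyC map_polyX !hornerE EG.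
  rewrite mulrDr mulrA -!(rmorphM inE) addrAC -rmorphD => /basis_eq0[e0 e1].
  have r1 : r`_1 = 0.
    by apply/eqP; move/eqP: e1; rewrite mulf_eq0 (negbTE B0) orbF (toF_eq0 toF_inj).
  have r0 : r`_0 = 0.
    by apply: toF_inj; rewrite raddf0 -e0 r1 raddf0 mul0r add0r.
  by rewrite [X in X%:P * _](r1 : _ = 0) [X in _ + X%:P](r0 : _ = 0) !polyC0 mul0r addr0.
have sp1 : (size p1 <= 3)%N.
  apply: leq_trans sYp; have -> : p1 = p`_1; last exact: max_size_coefXY.
  by rewrite /p !(coefD, coefCM, coefXn, coefX, coefC) /= mulr0 mulr1 addr0 add0r.
(* For P = p2 A the norm gives h (P^2 + p1 P) = h p0 p2 - p1^2 m', to which the comparison of poles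
   at h applies. *)
have hp1 : h %| p1 ^+ 2 * m'.
  have : h %| h * (p0 * p2) - p1 ^+ 2 * m'.
    apply: (simple_pole_absurd toF_inj toF_frac irr h_ndvd1 (c := p1) (P := toF p2 * A)).
    rewrite mulr1 !(rmorphM, rmorphB, rmorphXn) -EB -EN /N.
    by field.
  by rewrite dvdp_subr ?dvdp_mulIl.
have /(irreducible_dvdX irr) : h %| p1 ^+ 2.
  by have := irreducible_dvdM irr hp1; rewrite (negbTE nhm') orbF.
have [p10|p10] := eqVneq p1 0; last first.
  by move=> /dvdp_leq; rewrite p10 hsz => /(_ isT); rewrite leqNgt ltnS sp1.
move/eqP: EB; rewrite p10 rmorph0 mulf_eq0 toF_eq0 // (negbTE p20).
by rewrite (negbTE B0).
Qed.

(** G being in k(x), a W in k(x) would by [EY] put y there as well. *)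
Lemma W_irrational (B : F) : W <> inE B.
Proof.
move=> WB; have [A GA] := G_rational.
have [e3 E3] := at_rational a3 GA; have [f3 F3] := at_rational b3 GA.
have [e4 E4] := at_rational a4 GA; have [f4 F4] := at_rational b4 GA.
have hE : ev h != 0 by rewrite ev_eq0 h_neq0.
apply: (@y_irrational ((e4 + f4 * B) / (e3 + f3 * B) / toF h)).
apply: (mulfI hE); apply: (mulfI mu0); rewrite EY E3 E4 F3 F4 WB.
have mu1 : inE e3 + inE f3 * inE B != 0 by rewrite -E3 -F3 -WB.
rewrite !fmorph_div !(rmorphD inE, rmorphM inE) /= in hE *.
by field; rewrite hE mu1.
Qed.

(** The coefficients in [Ex] now lie in k(x), over which 1 and W are independent, so the relation
    splits. *)
Lemma x_over_G :
  at_ a3 * ev 'X = at_ a2 /\ at_ b3 * ev 'X = at_ b2.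
Proof.
have [A GA] := G_rational.
have [e3 E3] := at_rational a3 GA; have [f3 F3] := at_rational b3 GA.
have [e2 E2] := at_rational a2 GA; have [f2 F2] := at_rational b2 GA.
have e0 : inE (e3 * toF 'X - e2) + inE (f3 * toF 'X - f2) * W = 0.
  rewrite !rmorphB !rmorphM -E3 -F3 -E2 -F2.
  by apply/eqP; rewrite -subr_eq0 -(subrr (at_ a2 + at_ b2 * W)) -{1}Ex /=; apply/eqP; ring.
have b0 : f3 * toF 'X - f2 = 0.
  apply/eqP; apply: contraT => b0; exfalso.
  apply: (@W_irrational (- (e3 * toF 'X - e2) / (f3 * toF 'X - f2))).
  have bE : inE (f3 * toF 'X - f2) != 0 by rewrite fmorph_eq0.
  apply: (mulIf bE); rewrite fmorph_div mulfVK // rmorphN.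
  by apply/eqP; rewrite -addr_eq0 addrC [W * _]mulrC e0.
move: e0; rewrite b0 rmorph0 mul0r addr0 => /eqP; rewrite fmorph_eq0.
rewrite subr_eq0 => /eqP a0; move/eqP: b0; rewrite subr_eq0 => /eqP b0.
by rewrite E3 E2 F3 F2 -a0 -b0 !rmorphM.
Qed.

(** For G = u/w in lowest terms, w T - u is the primitive equation of G over k[x]; a relation p(G) x
    = q(G) has degree one in x, which by Gauss's lemma bounds the degrees of u and w. *)
Lemma G_degree1 : exists u w,
  [/\ coprimep u w, (size u <= 2)%N, (size w <= 2)%N, w != 0 & G * ev w = ev u].
Proof.
have [A GA] := G_rational; have [u [w [w0 cuw EA]]] := toF_frac A.
have wE : ev w != 0 by rewrite ev_eq0.
have EG : G * ev w = ev u by rewrite GA EA fmorph_div /= mulfVK.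
have [p [q [p0 Ep]]] : exists p q, p != 0 /\ at_ p * ev 'X = at_ q.
  have [xa xb] := x_over_G; have [a0|a0] := eqVneq a3 0; last by exists a3, a2.
  exists b3, b2; split=> //; apply: contraNneq mu0 => b0.
  by rewrite a0 b0 rmorph0 horner0 mul0r addr0.
suff sY : (sizeY (w%:P * 'X - u%:P) <= 2)%N.
  exists u, w; split=> //; apply: leq_trans sY.
    have {1}-> : u = - (w%:P * 'X - u%:P)`_0.
      by rewrite coefB coefCM coefX coefC mulr0 sub0r opprK.
    by rewrite size_polyN max_size_coefXY.
  have {1}-> : w = (w%:P * 'X - u%:P)`_1.
    by rewrite coefB coefCM coefX coefC mulr1 subr0.
  exact: max_size_coefXY.
have lin (v v' : {poly k}) : v != 0 -> size (v%:P * 'X - v'%:P) = 2%N.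
  move=> v0; rewrite -polyCN size_MXaddC polyC_eq0 (negbTE v0) /=.
  by rewrite size_polyC v0.
have := lin p q p0 => spq.
rewrite -[leqRHS]spq -[in leqRHS](swapXYK (p%:P * 'X - q%:P)) -sizeYE.
apply: (sizeY_minimal (G := G)) => [t||||r].
- apply: contraTneq isT => pt; exfalso.
  have ci (i : 'I_2) : root (map_poly inK (w%:P * 'X - u%:P)`_i) t.
    have := congr1 (fun f : {poly K} => f`_i) pt.
    by rewrite coef_map coef0 => /eqP.
  have := ci (Ordinal (isT : 0 < 2)%N); have := ci (Ordinal (isT : 1 < 2)%N).
  rewrite !(coefB, coefCM, coefX, coefC) /= mulr0 mulr1 subr0 sub0r.
  move=> rw ru; have : root (map_poly inK (gcdp u w)) t.
    by rewrite gcdp_map root_gcd rw andbT; move: ru; rewrite rmorphN rootN.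
  have /size_poly1P[e e0 ->] := cuw.
  by rewrite map_polyC rootC fmorph_eq0 (negbTE e0).
- by rewrite swapXY_eq0 -size_poly_eq0 spq.
- apply: etrans (rmorphB (swap_ev G) _ _) _; rewrite (rmorphM (swap_ev G)) /=.
  by rewrite !swap_evC swap_evX Ep subrr.
- rewrite rmorphB rmorphM /= !map_polyC map_polyX /=.
  by rewrite hornerD hornerN hornerM !hornerC hornerX; have /= <- := EG; rewrite mulrC subrr.
rewrite lin // ltnS => sr; rewrite (size1_polyC sr) map_polyC hornerC /= => /eqP.
by rewrite fmorph_eq0 (toF_eq0 toF_inj) => /eqP ->.
Qed.

(** For W = P + Q y, the coefficient of y in W^2 + W is Q^2 + Q. It vanishes because W^2 + W =
    m(G)/h(G) is in k(x), and Q = 0 is excluded by the irrationality of W. *)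
Lemma W_eq : exists P, W = inE P + y.
Proof.
have [A GA] := G_rational.
have [P [Q EWPQ]] := basis W.
have [h' Eh'] := at_rational h GA; have [n Em] := at_rational m GA.
have hF : toF h != 0 by rewrite toF_eq0 // h_neq0.
have hE : inE (toF h) != 0 by rewrite fmorph_eq0.
have yy : y ^+ 2 + y = inE (toF m' / toF h).
  by apply: (mulfI hE); rewrite Ey /= fmorph_div /= mulrCA mulfV ?mulr1.
have h'0 : inE h' != 0 by rewrite -Eh'.
have WW : W ^+ 2 + W = inE (n / h').
  by apply: (mulfI hG); rewrite EW Em Eh' fmorph_div /= mulrCA mulfV ?mulr1.
have [_ /eqP] : P ^+ 2 + P + Q ^+ 2 * (toF m' / toF h) + n / h' = 0 /\ Q ^+ 2 + Q = 0.
  apply: basis_eq0; move: (_ / toF h) yy (n / h') WW => f0 yy f1 WW.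
  rewrite !(rmorphD inE, rmorphXn inE, rmorphM inE) -yy -WW EWPQ.
  apply: (addE2 (c := inE P ^+ 2 + inE P + inE Q ^+ 2 * (y ^+ 2 + y)
    + inE Q * y + inE P * inE Q * y)).
  by ring.
have -> : Q ^+ 2 + Q = Q * (Q + 1) by ring.
rewrite mulf_eq0 => /orP[/eqP Q0|].
  by case: (@W_irrational P); rewrite EWPQ Q0 rmorph0 mul0r addr0.
rewrite addr_eq0 => /eqP Q1; exists P.
by rewrite EWPQ Q1 rmorphN rmorph1 (oppr_pchar2 char2) mul1r.
Qed.

(** Non-cyclicity of the cubic extension enters only here, through [cubic_noaut]: no fractional
    linear map over k other than the identity permutes the roots of h. *)
Hypothesis noaut : forall u w, (size u <= 2)%N -> (size w <= 2)%N ->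
  w != 0 -> h %| hom3 h u w -> u = 'X * w.
Hypothesis msz : (size m <= 4)%N.
Hypothesis msz' : (size m' <= 4)%N.

(** Here P^2 + P = m(G)/h(G) - m'/h, and the simple pole of m'/h at h must be cancelled; so h
    divides the numerator [hom3 h u w] of h(G). *)
Lemma G_eq : G = ev 'X.
Proof.
have [u [w [cuw su sw w0 EG]]] := G_degree1.
have wE : ev w != 0 by rewrite ev_eq0.
suff hh : h %| hom3 h u w.
  apply: (mulIf wE); rewrite EG (noaut su sw w0 hh) /=.
  by rewrite -(rmorphM inE) -(rmorphM toF).
have [P WP] := W_eq.
apply: contraT => nhh.
(* The numerator of that difference over [h * hom3 h u w], in which h would be a simple factor. *)
have : h %| h * hom3 m u w - hom3 h u w * m'.
  apply: (simple_pole_absurd toF_inj toF_frac irr nhh (c := 1) (P := P)).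
  apply: (fmorph_inj inE); rewrite rmorph1 mul1r.
  have e1 : inE (toF (hom3 h u w)) = at_ h * ev w ^+ 3.
    exact: (@hom3E k E ev h u w G (eq_leq hsz) EG).
  have e2 : inE (toF (hom3 m u w)) = at_ m * ev w ^+ 3.
    exact: (@hom3E k E ev m u w G msz EG).
  have R1 (a b c d : {poly k}) : ev (a * b - c * d) = ev a * ev b - ev c * ev d.
    by rewrite !(rmorphB, rmorphM).
  have R2 (a b : {poly k}) :
      inE (toF (a * b) * (P ^+ 2 + P)) = ev a * ev b * (inE P ^+ 2 + inE P).
    by rewrite !(rmorphM, rmorphD, rmorphXn).
  rewrite R2; apply: etrans _ (esym (R1 _ _ _ _)).
  rewrite -Ey /= e1 e2 -EW WP.
  by apply: (addE2 (c := - (ev h * at_ h * ev w ^+ 3 * inE P * y))); rewrite /=; ring.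
rewrite dvdp_subr ?dvdp_mulIl // => /(irreducible_dvdM irr).
by rewrite (negbTE nhh) (negbTE nhm').
Qed.

(** The reduced denominator w of P = u/w divides u^2, so it is constant; then P^2 outgrows P unless
    P is constant. *)
Lemma AS_const (P : F) (e : k) : P ^+ 2 + P = toF e%:P -> exists c, P = toF c%:P.
Proof.
have [u [w [w0 cuw ->]]] := toF_frac P => EP.
have wF : toF w != 0 by rewrite toF_eq0.
have Eu : u ^+ 2 = (e%:P * w - u) * w.
  apply: toF_inj; rewrite [LHS]rmorphXn [RHS]rmorphM rmorphB rmorphM -EP.
  by field.
have /size_poly1P[c c0 Ew] : size w == 1%N.
  have : coprimep (u ^+ 2) w by apply: coprimep_expl.
  by rewrite Eu coprimep_sym coprimepMr coprimepp => /andP[].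
have {}Eu : u ^+ 2 + c *: u = (e * c ^+ 2)%:P.
  by rewrite Eu Ew -mul_polyC !(rmorphM, rmorphXn) /=; ring.
have : (size u <= 1)%N.
  rewrite leqNgt; apply/negP => su.
  have su2 : (size u < size (u ^+ 2)%R)%N.
    have u0 : u != 0 by rewrite -size_poly_gt0 ltnW.
    rewrite expr2 size_mul //; case: (size u) su => [|[|n]] //= _.
    by rewrite !addnS !ltnS leq_addl.
  have := size_polyC_leq1 (e * c ^+ 2); rewrite -Eu size_polyDl ?size_scale //.
  by rewrite leqNgt (ltn_trans su su2).
move/size1_polyC => ->; exists (u`_0 / c).
have cF : toF w != 0 by [].
apply: (mulIf cF); rewrite mulfVK // Ew -rmorphM -polyCM mulfVK //.
Qed.

(** With G = x the quotient (m - m')/h equals P^2 + P, so it has no pole at h and, by degrees, is a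
    constant; P is then constant too. *)
Lemma generic_isomorphism :
  G = ev 'X /\ exists c, W = y + evC c /\ m - m' = (c ^+ 2 + c)%:P * h.
Proof.
have GX := G_eq; split=> //; have [P WP] := W_eq.
have hF : toF h != 0 by rewrite toF_eq0 // h_neq0.
have EP : toF h * (P ^+ 2 + P) = toF (m - m').
  apply: (fmorph_inj inE).
  have -> : inE (toF (m - m')) = ev m - ev m' by rewrite !rmorphB.
  have -> : inE (toF h * (P ^+ 2 + P)) = ev h * (inE P ^+ 2 + inE P).
    by rewrite !(rmorphM, rmorphD, rmorphXn).
  move: EW; rewrite GX !ev_X -Ey => <-; rewrite WP.
  by apply: (addE2 (c := - (ev h * inE P * y))); rewrite /=; ring.
have /dvdpP[e Ee] : h %| m - m'.
  apply: (simple_pole_absurd toF_inj toF_frac irr h_ndvd1 (c := 1) (P := P)).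
  by rewrite mulr1 rmorph1 mul1r.
have se : (size e <= 1)%N.
  have [->|e0] := eqVneq e 0; first by rewrite size_poly0.
  have : (size (m - m')%R <= 4)%N.
    by rewrite (leq_trans (size_polyD _ _)) // size_polyN geq_max msz.
  by rewrite Ee size_mul ?h_neq0 // hsz addnS /= (leq_add2r 3 _ 1).
have {}EP : P ^+ 2 + P = toF (e`_0)%:P.
  by apply: (mulfI hF); rewrite EP -(size1_polyC se) Ee rmorphM mulrC.
have [c Pc] := AS_const EP; exists c; rewrite addrC WP Pc; split=> //.
rewrite Ee (size1_polyC se); congr (_ * h); apply: toF_inj.
by rewrite -EP Pc polyCD polyC_exp rmorphD rmorphXn.
Qed.

End GenericPoint.

(** * Cyclic cubic extensions *)

Lemma size_cubic (k : fieldType) (s : k) : size (cubic s) = 4.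
Proof.
rewrite /cubic -addrA size_polyDl size_polyXn // (leq_ltn_trans (size_polyD _ _)) //.
rewrite gtn_max (leq_ltn_trans (size_scale_leq _ _)) ?size_polyX //.
by rewrite (leq_ltn_trans (size_polyC_leq1 _)).
Qed.

Lemma monic_cubic (k : fieldType) (s : k) : cubic s \is monic.
Proof.
apply/monicP; rewrite lead_coefE size_cubic /cubic.
by rewrite !(coefD, coefZ, coefXn, coefX, coefC) /= mulr0 !addr0.
Qed.

Lemma irreducible_size_root (k : fieldType) (L : fieldExtType k) (h p : {poly k}) (z : L) :
  irreducible_poly h -> root (map_poly (in_alg L) h) z ->
  root (map_poly (in_alg L) p) z -> h %| p.
Proof.
move=> irr hz pz; apply: contraT; rewrite -irreducible_poly_coprime //.
move=> /size_poly1P[c c0 gE].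
have : root (map_poly (in_alg L) (gcdp h p)) z by rewrite gcdp_map root_gcd hz pz.
by rewrite gE map_polyC rootC fmorph_eq0 (negbTE c0).
Qed.

(** Two roots in k(z) bring in the third through the sum of the roots, so k(z) is the splitting
    field of a separable cubic; its Galois group has order three. *)
Lemma cubic_cyclic (k : fieldType) (h : {poly k}) (L : splittingFieldType k) (z z' : L) :
  irreducible_poly h -> separable_poly h -> size h = 4 -> h \is monic ->
  root (map_poly (in_alg L) h) z -> root (map_poly (in_alg L) h) z' ->
  z' != z -> z' \in <<1%VS; z>>%VS -> cyclic_extension 1%AS <<1%AS; z>>%AS.
Proof.
move=> irr sep sh hmon hz hz' neq z'in.
set hL := map_poly (in_alg L) h in hz hz' *.
have sL : size hL = 4 by rewrite size_map_poly.
have mL : hL \is monic by rewrite map_monic.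
have [c Ec] : exists c, hL = \prod_(x <- [:: z; z'; c]) ('X - x%:P).
  have : all (root hL) [:: z; z'] by rewrite /= hz hz'.
  move/uniq_roots_prod_XsubC; rewrite uniq_rootsE /= inE eq_sym neq => /(_ isT)[q Eq].
  have sp : size (\prod_(x <- [:: z; z']) ('X - x%:P)) = 3 by rewrite size_prod_XsubC.
  have q0 : q != 0 by apply: contraTneq mL => q0; rewrite Eq q0 mul0r monicE lead_coef0 eq_sym oner_eq0.
  have mq : q \is monic.
    by move: mL; rewrite Eq monicMr // monic_prod_XsubC.
  have sq : size q = 2.
    by move: sL; rewrite Eq size_Mmonic ?monic_prod_XsubC // sp addn3 /= => -[].
  exists (- q`_0); rewrite Eq !big_cons !big_nil mulr1 [RHS]mulrA mulr1 mulrC; congr (_ * _).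
  rewrite polyCN opprK; apply/polyP => i; rewrite coefD coefX coefC.
  case: i => [|[|i]] /=; rewrite ?add0r ?addr0 //.
    by move/monicP: mq; rewrite lead_coefE sq.
  by rewrite nth_default // sq.
have cin : c \in <<1%VS; z>>%VS.
  have E2 : hL`_2 = - (z + z' + c).
    have -> : hL = 'X^3 - (z + z' + c)%:P * 'X^2 + (z * z' + z' * c + c * z)%:P * 'X
        - (z * z' * c)%:P.
      by rewrite Ec !big_cons big_nil; ring.
    rewrite !(coefD, coefN, coefCM, coefXn, coefX, coefC) /=.
    by rewrite mulr1 mulr0 add0r addr0 subr0.
  have -> : c = - hL`_2 - z - z' by rewrite E2; ring.
  rewrite !memvB ?memv_adjoin // memvN coef_map /=.
  by apply: (subvP (sub1v _)); apply: memvZ; apply: mem1v.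
have gal : galois 1%AS <<1%AS; z>>%AS.
  apply/splitting_galoisField; exists hL; split.
  - exact: alg_polyOver.
  - by rewrite separable_map.
  - exists [:: z; z'; c]; first by rewrite Ec eqpxx.
    apply/eqP; rewrite eqEsubv; apply/andP; split.
      apply/Fadjoin_seqP; split; first exact: subv_adjoin.
      by move=> x; rewrite !inE => /or3P[] /eqP -> //; apply: memv_adjoin.
    apply/FadjoinP; split; first exact: subv_adjoin_seq.
    by apply: seqv_sub_adjoin; rewrite inE eqxx.
rewrite /cyclic_extension gal /=; apply: prime_cyclic.
rewrite -(galois_dim gal) /= dim_Fadjoin /= dimv1 divn1 muln1.
suff -> : adjoin_degree 1%VS z = 3 by [].
apply/eqP; rewrite -eqSS -size_minPoly.
have /polyOver1P[p Ep] := minPolyOver 1%VS z.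
have hp : h %| p by apply: (irreducible_size_root irr hz); rewrite -Ep root_minPoly.
have hm : hL %| minPoly 1%VS z by rewrite Ep dvdp_map.
have mh : minPoly 1%VS z %| hL.
  by apply: minPoly_dvdp => //; apply: alg_polyOver.
rewrite [X in _ == X](esym sL) eqn_leq !dvdp_leq ?monic_neq0 ?monic_minPoly //.
Qed.

(** The value z' of u/w at z is again a root of h, in k(z). If z' differs from z, then k(z) is
    cyclic, perfectness giving separability; if z' = z, then u - x w has degree at most two and
    vanishes at z, so it is zero. *)
Lemma cubic_noaut (k : fieldType) (s : k) (L : splittingFieldType k) (z : L) :
  perfect_field k -> irreducible_poly (cubic s) ->
  root (map_poly (in_alg L) (cubic s)) z ->
  ~~ cyclic_extension 1%AS <<1%AS; z>>%AS ->
  forall u w : {poly k}, (size u <= 2)%N -> (size w <= 2)%N ->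
  w != 0 -> cubic s %| hom3 (cubic s) u w -> u = 'X * w.
Proof.
move=> perf irr hz ncyc u w su sw w0 hh.
pose phi : {rmorphism {poly k} -> L} := horner_eval z \o map_poly (in_alg L).
have inj0 (p : {poly k}) : (size p <= 3)%N -> phi p = 0 -> p = 0.
  move=> sp p0; apply/eqP; apply: contraTT sp => pn; rewrite -ltnNge.
  have /(dvdp_leq pn) : cubic s %| p.
    by apply: (irreducible_size_root irr hz); apply/eqP.
  by rewrite size_cubic.
have phiw : phi w != 0.
  by apply: contraNneq w0 => /inj0 -> //; rewrite (leq_trans sw).
pose z' := phi u / phi w.
have Ez' : z' * phi w = phi u by rewrite mulfVK.
have hz' : root (map_poly (in_alg L) (cubic s)) z'.
  have /dvdpP[e Ee] := hh; apply/eqP.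
  apply: (mulIf (expf_neq0 3 phiw)); rewrite mul0r.
  have := @hom3E k L phi (cubic s) u w z' (eq_leq (size_cubic s)) Ez'.
  rewrite Ee rmorphM /= {2}/horner_eval (rootP hz) mulr0 => ->.
  congr (_.[_] * _); apply: eq_map_poly => c /=.
  by rewrite /horner_eval map_polyC hornerC.
have mem (p : {poly k}) : phi p \in <<1%VS; z>>%VS.
  rewrite /= /horner_eval mempx_Fadjoin //; exact: alg_polyOver.
have [zz|zz] := eqVneq z' z.
  apply/eqP; rewrite -subr_eq0; apply/eqP/inj0.
    rewrite (leq_trans (size_polyD _ _)) // size_polyN geq_max (leq_trans su) //=.
    by rewrite mulrC size_mulX // ltnS.
  by rewrite rmorphB rmorphM -Ez' zz /= /horner_eval map_polyX hornerX subrr.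
case/negP: ncyc; apply: (cubic_cyclic irr _ (size_cubic s) (monic_cubic s) hz hz' zz).
  exact: perf.
by rewrite memvM ?memvV.
Qed.

(** * Forms at the generic point *)

Section Evaluation.
Variables (k : fieldType) (n : nat).

Lemma rmorph_mmap (A B : comNzRingType) (f : {rmorphism k -> A}) (g : {rmorphism A -> B})
    (v : 'I_n -> A) (M : {mpoly k[n]}) :
  g (mmap f v M) = mmap (g \o f) (g \o v) M.
Proof.
rewrite /mmap rmorph_sum; apply: eq_bigr => i _; rewrite rmorphM /mmap1 rmorph_prod.
by congr (_ * _); apply: eq_bigr => j _; rewrite rmorphXn.
Qed.

Lemma eq_mmap (A : comNzRingType) (f g : k -> A) (v w : 'I_n -> A) (M : {mpoly k[n]}) :
  f =1 g -> v =1 w -> mmap f v M = mmap g w M.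
Proof.
move=> fg vw; apply: eq_bigr => i _; rewrite fg; congr (_ * _).
by apply: eq_bigr => j _; rewrite vw.
Qed.

Lemma mmap_homog (A : comNzRingType) (f : {rmorphism k -> A}) (v : 'I_n -> A)
    (l : A) (e : nat) (M : {mpoly k[n]}) :
  M \is e.-homog -> mmap f (fun i => l * v i) M = l ^+ e * mmap f v M.
Proof.
move=> /dhomogP hM; rewrite /mmap big_distrr /=; apply: eq_big_seq => m mM.
rewrite mulrCA; congr (_ * _); rewrite /mmap1.
have <- : mdeg m = e := hM m mM.
rewrite mdegE expr_sum -big_split /=.
by apply: eq_bigr => i _; rewrite exprMn.
Qed.

Lemma value_at_mmap (K : closedFieldType) (inK : {rmorphism k -> K}) (M : {mpoly k[n]}) (v : 'rV[K]_n) :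
  value_at inK M v = mmap inK (v 0) M.
Proof.
rewrite /value_at [in LHS](mpolyE M) (raddf_sum (map_mpoly inK)) raddf_sum /mmap /=.
apply: eq_bigr => m _ /=.
by rewrite map_mpolyZ /= mevalZ map_mpolyX mevalX.
Qed.

End Evaluation.

(** The chart u3 = 1, with Y = h y; the ring is arbitrary so that it serves both K-points and the
    generic point. *)
Definition aff_coord (A : nzRingType) (x Y : A) (i : 'I_5) : A :=
  [:: x ^+ 3; x ^+ 2; x; 1; Y]`_i.

(** The chart u0 = 1, with t = 1/x. *)
Definition inf_coord (A : nzRingType) (t Y : A) (i : 'I_5) : A :=
  [:: 1; t; t ^+ 2; t ^+ 3; Y]`_i.

Lemma aff_coordE (A B : nzRingType) (f : {rmorphism A -> B}) (x Y : A) i :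
  f (aff_coord x Y i) = aff_coord (f x) (f Y) i.
Proof.
by case: i => -[|[|[|[|[|]]]]] //= lt; rewrite /aff_coord /= ?rmorphXn ?rmorph1.
Qed.

Lemma inf_coordE (A B : nzRingType) (f : {rmorphism A -> B}) (x Y : A) i :
  f (inf_coord x Y i) = inf_coord (f x) (f Y) i.
Proof.
by case: i => -[|[|[|[|[|]]]]] //= lt; rewrite /inf_coord /= ?rmorphXn ?rmorph1.
Qed.

Lemma closed_quadratic (K : closedFieldType) (H g : K) : exists Y, Y ^+ 2 + H * Y = g.
Proof.
have /closed_rootP[Y rY] : size ('X^2 + (H%:P * 'X - g%:P)) != 1%N.
  rewrite size_polyDl size_polyXn // -polyCN size_MXaddC; case: ifP => // _.
  by rewrite !ltnS size_polyC_leq1.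
exists Y; apply/eqP; rewrite -subr_eq0 -addrA; move: rY; rewrite /root.
by rewrite !(hornerD, hornerN, hornerCM, hornerC, hornerX, hornerXn).
Qed.

Section Reduction.
Variables (k : fieldType) (hh gg : {poly k}).

(** Division by the monic Y^2 + hh Y - gg. The pair r1, r0 does not depend on A, so one pair
    describes a form at the K-points and at the generic point. *)
Lemma quadratic_reduction (P : {poly {poly k}}) : exists r1 r0 : {poly k},
  forall (A : comNzRingType) (f : {rmorphism {poly k} -> A}) (Y : A),
    Y ^+ 2 + f hh * Y = f gg -> (map_poly f P).[Y] = f r0 + f r1 * Y.
Proof.
pose D : {poly {poly k}} := 'X^2 + (hh%:P * 'X - gg%:P).
have sD' : (size (hh%:P * 'X - gg%:P)%R < 3)%N.
  rewrite -polyCN size_MXaddC; case: ifP => // _.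
  by rewrite !ltnS size_polyC_leq1.
have sD : size D = 3 by rewrite size_polyDl size_polyXn.
have mD : D \is monic.
  apply/monicP; rewrite lead_coefE sD coefD coefXn [X in _ + X]nth_default ?addr0 //.
have := Pdiv.IdomainMonic.divp_eq mD P; set Q := _ %/ _; set r := _ %% _ => EP.
have sr : (size r <= 2)%N.
  by rewrite -ltnS -[X in (_ < X)%N]sD Pdiv.Idomain.ltn_modp monic_neq0.
exists r`_1, r`_0 => A f Y EY.
have Er : r = (r`_1)%:P * 'X + (r`_0)%:P.
  apply/polyP => i; rewrite coefD coefCM coefX coefC.
  case: i => [|[|i]] /=; rewrite ?(mulr0, mulr1, add0r, addr0) //.
  by rewrite nth_default // (leq_trans sr).
rewrite EP rmorphD rmorphM /= hornerD hornerM.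
have -> : (map_poly f D).[Y] = 0.
  rewrite /D rmorphD rmorphB rmorphXn rmorphM /= !map_polyC map_polyX.
  by rewrite !(hornerD, hornerN, hornerCM, hornerC, hornerX, hornerXn) addrA EY subrr.
rewrite mulr0 add0r {1}Er rmorphD rmorphM /= !map_polyC map_polyX.
by rewrite !(hornerD, hornerCM, hornerC, hornerX) addrC.
Qed.

Lemma mmap_reduction (c : 'I_5 -> {poly {poly k}}) (M : {mpoly k[5]}) :
  exists r1 r0 : {poly k},
  forall (A : comNzRingType) (f : {rmorphism {poly k} -> A}) (Y : A),
    Y ^+ 2 + f hh * Y = f gg ->
    mmap (f \o polyC) (fun i => (map_poly f (c i)).[Y]) M = f r0 + f r1 * Y.
Proof.
have [r1 [r0 E]] := quadratic_reduction (mmap (polyC \o polyC) c M).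
exists r1, r0 => A f Y EY; rewrite -(E A f Y EY).
pose g : {rmorphism {poly {poly k}} -> A} := horner_eval Y \o map_poly f.
have <- : g (mmap (polyC \o polyC) c M) = (map_poly f (mmap (polyC \o polyC) c M)).[Y].
  by [].
rewrite (rmorph_mmap (polyC \o polyC : {rmorphism k -> {poly {poly k}}}) g).
by apply: eq_mmap => [e|i] //=; rewrite /horner_eval map_polyC hornerC.
Qed.

Lemma aff_reduction (M : {mpoly k[5]}) : exists r1 r0 : {poly k},
  forall (A : comNzRingType) (f : {rmorphism {poly k} -> A}) (Y : A),
    Y ^+ 2 + f hh * Y = f gg ->
    mmap (f \o polyC) (aff_coord (f 'X) Y) M = f r0 + f r1 * Y.
Proof.
have [r1 [r0 E]] := mmap_reduction (aff_coord 'X%:P 'X) M.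
exists r1, r0 => A f Y EY; rewrite -(E A f Y EY); apply: eq_mmap => // i.
pose g : {rmorphism {poly {poly k}} -> A} := horner_eval Y \o map_poly f.
apply: etrans _ (esym (aff_coordE g _ _ i)).
by rewrite /= /horner_eval map_polyC map_polyX hornerC hornerX.
Qed.

Lemma inf_reduction (M : {mpoly k[5]}) : exists r1 r0 : {poly k},
  forall (A : comNzRingType) (f : {rmorphism {poly k} -> A}) (Y : A),
    Y ^+ 2 + f hh * Y = f gg ->
    mmap (f \o polyC) (inf_coord (f 'X) Y) M = f r0 + f r1 * Y.
Proof.
have [r1 [r0 E]] := mmap_reduction (inf_coord 'X%:P 'X) M.
exists r1, r0 => A f Y EY; rewrite -(E A f Y EY); apply: eq_mmap => // i.
pose g : {rmorphism {poly {poly k}} -> A} := horner_eval Y \o map_poly f.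
apply: etrans _ (esym (inf_coordE g _ _ i)).
by rewrite /= /horner_eval map_polyC map_polyX hornerC hornerX.
Qed.

Variables (K : closedFieldType) (inK : {rmorphism k -> K}).

(** Over one t the roots Y and -Y - hh(t) give r1(t) hh(t) = 0 in characteristic two; so r1 and r0
    vanish at all t outside the zeros of q hh. The polynomial q allows finitely many t to be left
    out. *)
Lemma quadratic_zero (q r1 r0 : {poly k}) : 2%N \in [pchar K] -> hh != 0 -> q != 0 ->
  (forall t Y : K, (map_poly inK q).[t] != 0 ->
     Y ^+ 2 + (map_poly inK hh).[t] * Y = (map_poly inK gg).[t] ->
     (map_poly inK r0).[t] + (map_poly inK r1).[t] * Y = 0) ->
  r1 = 0 /\ r0 = 0.
Proof.
move=> ch hh0 q0 V.
have van t : (map_poly inK (q * hh)).[t] != 0 ->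
    (map_poly inK r1).[t] = 0 /\ (map_poly inK r0).[t] = 0.
  rewrite rmorphM hornerM mulf_eq0 negb_or => /andP[qt ht].
  set H := (map_poly inK hh).[t] in ht *; set g := (map_poly inK gg).[t].
  have [Y EY] := closed_quadratic H g.
  have E1 := V t Y qt EY.
  have E2 := V t (- Y - H) qt (etrans (_ : _ = Y ^+ 2 + H * Y) EY).
  have {}E2 := E2 ltac:(rewrite -/H; ring).
  have r1t : (map_poly inK r1).[t] = 0.
    apply: (mulIf ht); rewrite mul0r.
    have : (map_poly inK r1).[t] * (Y - (- Y - H)) = 0.
      rewrite -(subrr ((map_poly inK r0).[t] + (map_poly inK r1).[t] * Y)) {2}E1 -{1}E2.
      by ring.
    by rewrite opprD !opprK addrA addrr_pchar2 // add0r.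
  by split=> //; move: E1; rewrite r1t mul0r addr0.
have fin (r : {poly k}) : (forall t, (map_poly inK (q * hh)).[t] != 0 ->
    (map_poly inK r).[t] = 0) -> r = 0.
  move=> rt; have : map_poly inK (r * (q * hh)) == 0.
    apply: contraT => /closed_nonrootP[t]; rewrite /root rmorphM hornerM.
    have [->|/rt ->] := eqVneq (map_poly inK (q * hh)).[t] 0.
      by rewrite mulr0 eqxx.
    by rewrite mul0r eqxx.
  by rewrite map_poly_eq0 !mulf_eq0 (negbTE q0) (negbTE hh0) !orbF => /eqP.
by split; apply: fin => t /van[].
Qed.

End Reduction.

Lemma quadratic_extension (F : fieldType) (f : F) :
  (forall t : F, t ^+ 2 + t <> f) ->
  exists (E : fieldType) (inE : {rmorphism F -> E}) (y : E),
    y ^+ 2 + y = inE f /\ forall e, exists A B, e = inE A + inE B * y.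
Proof.
move=> noroot; pose p : {poly F} := 'X^2 + (1%:P * 'X - f%:P).
have sp' : (size (1%:P * 'X - f%:P)%R < 3)%N.
  by rewrite -polyCN size_MXaddC; case: ifP => // _; rewrite !ltnS size_polyC_leq1.
have sp : size p = 3 by rewrite size_polyDl size_polyXn.
have mp : p \is monic.
  by apply/monicP; rewrite lead_coefE sp coefD coefXn [X in _ + X]nth_default ?addr0.
have irr : irreducible_poly p.
  apply: cubic_irreducible => [|t]; first by rewrite sp.
  apply/negP => /eqP; rewrite !(hornerD, hornerN, hornerCM, hornerC, hornerX, hornerXn).
  by rewrite mul1r addrA => /eqP; rewrite subr_eq0 => /eqP; apply: noroot.
have [E _ [y ry Ey]] := irredp_FAdjoin irr.
exists E, (in_alg E), y; split.
  move: ry; rewrite /root /p rmorphD rmorphB rmorphXn rmorphM /= !map_polyC map_polyX.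
  rewrite !(hornerD, hornerN, hornerCM, hornerC, hornerX, hornerXn) /=.
  by rewrite scale1r mul1r addrA subr_eq0 => /eqP.
move=> e; have : e \in <<1; y>>%VS by rewrite Ey memvf.
move=> /Fadjoin_polyP[_ /polyOver1P[q ->] ->].
have := Pdiv.IdomainMonic.divp_eq mp q; set Q := _ %/ _; set r := _ %% _ => Eq.
have sr : (size r <= 2)%N.
  by rewrite -ltnS -[X in (_ < X)%N]sp Pdiv.Idomain.ltn_modp monic_neq0.
exists r`_0, r`_1; rewrite Eq rmorphD rmorphM /= hornerD hornerM (rootP ry) mulr0 add0r.
rewrite (@horner_coef_wide _ 2) ?size_map_poly //.
by rewrite !big_ord_recl big_ord0 /= !coef_map /= addr0 mulr1.
Qed.

Lemma tofrac_inj (k : fieldType) : injective (@FracField.tofrac {poly k}).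
Proof. by move=> p q /eqP; rewrite tofrac_eq => /eqP. Qed.

(** * Equations of the curve and its affine chart *)

Section CurvePoints.
Variables (k : fieldType) (K : closedFieldType) (inK : {rmorphism k -> K}).
Variables (s a b c d : k).

(** t^3 h(1/t), for the chart at infinity. *)
Definition cubicI : {poly k} := 1 + s *: 'X^2 + s *: 'X^3.

(** The right-hand side of the model multiplied by h. *)
Definition rhs : {poly k} := (a *: 'X^2 + b *: 'X + c%:P) + d *: cubic s.

(** t^3 m(1/t), with m = [rhs]. *)
Definition rhsI : {poly k} := (a *: 'X + b *: 'X^2 + c *: 'X^3) + d *: cubicI.

Definition on_curve (v : 'rV[K]_5) : Prop :=
  [/\ u_at v 0 * u_at v 2 = u_at v 1 ^+ 2, u_at v 0 * u_at v 3 = u_at v 1 * u_at v 2,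
      u_at v 1 * u_at v 3 = u_at v 2 ^+ 2 &
      u_at v 4 ^+ 2 + H_at inK s v * u_at v 4 =
        H_at inK s v * (inK a * u_at v 1 + inK b * u_at v 2 + inK c * u_at v 3)
         + inK d * H_at inK s v ^+ 2].

Definition affv (x Y : K) : 'rV[K]_5 := \row_i aff_coord x Y i.

Lemma rhs_at (A : comNzRingType) (f : {rmorphism k -> A}) x :
  (map_poly f rhs).[x] = f a * x ^+ 2 + f b * x + f c + f d * (map_poly f (cubic s)).[x].
Proof.
rewrite /rhs; move: (cubic s) => h; rewrite !rmorphD /= !linearZ /=.
rewrite map_polyXn map_polyX map_polyC.
by rewrite !(hornerD, hornerZ, hornerXn, hornerX, hornerC).
Qed.

Lemma u_at_aff x Y i : (i < 5)%N -> u_at (affv x Y) i = [:: x ^+ 3; x ^+ 2; x; 1; Y]`_i.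
Proof. by move=> i5; rewrite /u_at mxE /aff_coord inordK. Qed.

Lemma affv_neq0 x Y : affv x Y != 0.
Proof.
apply: contraTneq isT => E; have := @u_at_aff x Y 3 isT.
by rewrite E /u_at mxE => /esym/eqP; rewrite oner_eq0.
Qed.

Lemma H_at_aff x Y : H_at inK s (affv x Y) = (map_poly inK (cubic s)).[x].
Proof. by rewrite /H_at !u_at_aff // -/(h_at _ _ _) h_atE /= mulr1. Qed.

Lemma on_curve_aff x Y :
  on_curve (affv x Y) <->
  Y ^+ 2 + (map_poly inK (cubic s)).[x] * Y = (map_poly inK (cubic s * rhs)).[x].
Proof.
rewrite /on_curve !u_at_aff //= H_at_aff rmorphM hornerM rhs_at.
have E (h : K) : h * (inK a * x ^+ 2 + inK b * x + inK c * 1) + inK d * h ^+ 2 =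
  h * (inK a * x ^+ 2 + inK b * x + inK c + inK d * h) by ring.
rewrite E; split=> [[]//|->]; split=> //; ring.
Qed.

Lemma on_curveZ l v : on_curve v -> on_curve (l *: v).
Proof.
have EZ i : u_at (l *: v) i = l * u_at v i by rewrite /u_at mxE.
have EH : H_at inK s (l *: v) = l * H_at inK s v by rewrite /H_at !EZ; ring.
case=> E1 E2 E3 E4; split; rewrite !EZ ?EH.
- by have -> : l * u_at v 0 * (l * u_at v 2) = l ^+ 2 * (u_at v 0 * u_at v 2) by [ring]; rewrite E1; ring.
- by have -> : l * u_at v 0 * (l * u_at v 3) = l ^+ 2 * (u_at v 0 * u_at v 3) by [ring]; rewrite E2; ring.
- by have -> : l * u_at v 1 * (l * u_at v 3) = l ^+ 2 * (u_at v 1 * u_at v 3) by [ring]; rewrite E3; ring.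
set h := H_at inK s v in E4 *.
have -> : (l * u_at v 4) ^+ 2 + l * h * (l * u_at v 4) = l ^+ 2 * (u_at v 4 ^+ 2 + h * u_at v 4) by ring.
by rewrite E4; ring.
Qed.

Lemma affine_chart v : on_curve v -> u_at v 3 != 0 ->
  v = u_at v 3 *: affv (u_at v 2 / u_at v 3) (u_at v 4 / u_at v 3).
Proof.
case=> E1 E2 E3 _ n3; set x := _ / _; set Y := u_at v 4 / _.
have e2 : u_at v 2 = u_at v 3 * x by rewrite mulrC mulfVK.
have e4 : u_at v 4 = u_at v 3 * Y by rewrite mulrC mulfVK.
have e1 : u_at v 1 = u_at v 3 * x ^+ 2 by apply: (mulIf n3); rewrite E3 e2; ring.
have e0 : u_at v 0 = u_at v 3 * x ^+ 3 by apply: (mulIf n3); rewrite E2 e2 e1; ring.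
apply: u_at_inj => i i5; rewrite {2}/u_at mxE -/(u_at _ _) u_at_aff //.
by case: i i5 => [|[|[|[|[|]]]]] //= _; rewrite mulr1.
Qed.

End CurvePoints.

Section GenericZero.
Variables (k : fieldType) (K : closedFieldType) (inK : {rmorphism k -> K}).
Hypothesis ch : 2%N \in [pchar k].
Variables (F : fieldType) (toF : {rmorphism {poly k} -> F}).
Hypothesis toF_inj : injective toF.
Hypothesis toF_frac : forall P, exists u w,
  [/\ w != 0, coprimep u w & P = toF u / toF w].
Variables (E : fieldType) (inE : {rmorphism F -> E}).
Local Notation ev := (inE \o toF).
Local Notation evC := (inE \o toF \o polyC).
Variables (s a b c d : k) (y : E).
Local Notation h := (cubic s).
Local Notation m := (rhs s a b c d).
Hypothesis irr : irreducible_poly h.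
Hypothesis nhm : ~~ (h %| m).
Hypothesis Ey : ev h * (y ^+ 2 + y) = ev m.

Definition generic_coord : 'I_5 -> E := aff_coord (ev 'X) (ev h * y).

Lemma pcharK : 2%N \in [pchar K].
Proof. exact: rmorph_pchar ch. Qed.

Lemma generic_relation : (ev h * y) ^+ 2 + ev h * (ev h * y) = ev (h * m).
Proof.
have -> : ev (h * m) = ev h * ev m by rewrite !rmorphM.
by rewrite -Ey; ring.
Qed.

(** In the affine chart M reduces to r0 + r1 Y. Both conditions then mean r0 = r1 = 0: the first
    because 1 and y are independent over k(x), the second by [quadratic_zero]. *)
Lemma generic_zeroP (M : {mpoly k[5]}) :
  mmap evC generic_coord M = 0 <->
  (forall x Y, on_curve inK s a b c d (affv x Y) -> value_at inK M (affv x Y) = 0).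
Proof.
have [r1 [r0 R]] := aff_reduction h (h * m) M.
have RK x Y : on_curve inK s a b c d (affv x Y) ->
    value_at inK M (affv x Y) = (map_poly inK r0).[x] + (map_poly inK r1).[x] * Y.
  move=> /on_curve_aff EY; rewrite value_at_mmap.
  pose f : {rmorphism {poly k} -> K} := horner_eval x \o map_poly inK.
  rewrite -(R K f Y EY); apply: eq_mmap => [e|i].
    by rewrite /= /horner_eval map_polyC hornerC.
  by rewrite /affv mxE /= /horner_eval map_polyX hornerX.
have RE : mmap evC generic_coord M = ev r0 + ev r1 * (ev h * y).
  exact: (R E ev _ generic_relation).
rewrite RE; split=> [e0 x Y XY|V].
  have e1 : inE (toF r0) + inE (toF (r1 * h)) * y = 0.
    by rewrite -e0 /= !rmorphM mulrA.
  have [/eqP r00 /eqP] := basis_eq0 toF_inj toF_frac irr nhm Ey e1.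
  rewrite toF_eq0 // mulf_eq0 [h == 0](negbTE (irredp_neq0 irr)) orbF => /eqP r10.
  move: r00; rewrite toF_eq0 // => /eqP r00.
  by rewrite RK // r00 r10 !rmorph0 !horner0 mul0r addr0.
have [-> ->] : r1 = 0 /\ r0 = 0.
  apply: (@quadratic_zero k h (h * m) K inK 1) => //.
  - exact: pcharK.
  - exact: irredp_neq0.
  - by rewrite oner_eq0.
  by move=> t Y _ /on_curve_aff tY; rewrite -RK //; apply: V.
by rewrite /= !rmorph0 mul0r addr0.
Qed.

Definition infv (t Y : K) : 'rV[K]_5 := \row_i inf_coord t Y i.

Lemma infv_affv t Y : t != 0 -> infv t Y = t ^+ 3 *: affv t^-1 (Y / t ^+ 3).
Proof.
move=> t0; apply/rowP => i; rewrite !mxE /inf_coord /aff_coord.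
by case: i => -[|[|[|[|[|]]]]] //= lt; field.
Qed.

Lemma on_curve_inf t Y : t != 0 ->
  Y ^+ 2 + (map_poly inK (cubicI s)).[t] * Y =
    (map_poly inK (cubicI s * rhsI s a b c d)).[t] ->
  on_curve inK s a b c d (affv t^-1 (Y / t ^+ 3)).
Proof.
move=> t0 EY; apply/on_curve_aff; rewrite rmorphM hornerM rhs_at.
have -> : (map_poly inK h).[t^-1] = (map_poly inK (cubicI s)).[t] / t ^+ 3.
  rewrite -/(h_at _ _ _) h_atE /cubicI !rmorphD /= !linearZ /= rmorph1 !map_polyXn.
  by rewrite !(hornerD, hornerZ, hornerXn, hornerC); field.
have Er : (map_poly inK (rhsI s a b c d)).[t] =
    inK a * t + inK b * t ^+ 2 + inK c * t ^+ 3 + inK d * (map_poly inK (cubicI s)).[t].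
  rewrite /rhsI; move: (cubicI s) => g; rewrite !rmorphD /= !linearZ /=.
  rewrite !map_polyXn map_polyX.
  by rewrite !(hornerD, hornerZ, hornerXn, hornerX).
move: EY; rewrite rmorphM hornerM Er; move: (map_poly inK (cubicI s)).[t] => g EY.
apply: (@etrans _ _ ((Y ^+ 2 + g * Y) / t ^+ 6)); first by field.
by rewrite EY; field.
Qed.

(** For the points off the affine chart, M is reduced to r0(t) + r1(t) Y in the chart at infinity;
    it vanishes for nonzero t, which forces r0 = r1 = 0, hence vanishing at t = 0 also. *)
Lemma generic_zero_all (M : {mpoly k[5]}) (e : nat) :
  (forall l v, value_at inK M (l *: v) = l ^+ e * value_at inK M v) ->
  mmap evC generic_coord M = 0 ->
  forall v, on_curve inK s a b c d v -> v != 0 -> value_at inK M v = 0.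
Proof.
move=> MZ /generic_zeroP V v Cv v0.
have [n3|n3] := eqVneq (u_at v 3) 0; last first.
  have Ev := affine_chart Cv n3.
  rewrite Ev MZ V ?mulr0 //.
  have -> : affv (u_at v 2 / u_at v 3) (u_at v 4 / u_at v 3) = (u_at v 3)^-1 *: v.
    by rewrite {6}Ev scalerA mulVf // scale1r.
  exact: on_curveZ.
(* When u3 = 0 the equations leave only u0 and the last coordinate, with u0 nonzero, so v is
   proportional to a vector [infv 0 w]. *)
case: Cv; rewrite n3 mulr0 => E1 _ /esym/eqP; rewrite mulr0 sqrf_eq0 => /eqP n2.
move: E1; rewrite n2 mulr0 => /esym/eqP; rewrite sqrf_eq0 => /eqP n1.
rewrite /H_at n1 n2 n3 !mulr0 !addr0 mulr0 add0r => E4.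
have n0 : u_at v 0 != 0.
  apply: contraNneq v0 => n0; apply/eqP/u_at_inj => i i5; rewrite {2}/u_at mxE.
  case: i i5 => [|[|[|[|[|]]]]] //= _; apply/eqP; rewrite -sqrf_eq0.
  by move: E4; rewrite n0 mul0r addr0 expr0n mulr0 => ->.
pose w := u_at v 4 / u_at v 0.
have e4 : u_at v 4 = u_at v 0 * w by rewrite mulrC mulfVK.
have -> : v = u_at v 0 *: infv 0 w.
  apply: u_at_inj => i i5; rewrite {2}/u_at !mxE /inf_coord inordK //.
  by case: i i5 => [|[|[|[|[|]]]]] //= _; rewrite ?expr0n ?mulr0 ?mulr1.
rewrite MZ; apply/eqP; rewrite mulf_eq0; apply/orP; right; apply/eqP.
have [r1 [r0 R]] := inf_reduction (cubicI s) (cubicI s * rhsI s a b c d) M.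
have RK t Y : Y ^+ 2 + (map_poly inK (cubicI s)).[t] * Y =
      (map_poly inK (cubicI s * rhsI s a b c d)).[t] ->
    value_at inK M (infv t Y) = (map_poly inK r0).[t] + (map_poly inK r1).[t] * Y.
  move=> EY; rewrite value_at_mmap.
  pose f : {rmorphism {poly k} -> K} := horner_eval t \o map_poly inK.
  rewrite -(R K f Y EY); apply: eq_mmap => [l|i].
    by rewrite /= /horner_eval map_polyC hornerC.
  by rewrite /infv mxE /= /horner_eval map_polyX hornerX.
have c0 : (map_poly inK (cubicI s)).[0] = 1.
  rewrite /cubicI !rmorphD /= !linearZ /= rmorph1 !map_polyXn.
  by rewrite !(hornerD, hornerZ, hornerXn, hornerC) !expr0n !mulr0 !addr0.
have cI0 : cubicI s != 0.
  by apply: contraTneq isT => Ec; move: c0; rewrite Ec rmorph0 horner0 => /esym/eqP; rewrite oner_eq0.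
have [r10 r00] : r1 = 0 /\ r0 = 0.
  (* The polynomial ['X] leaves out t = 0, where the point is not in the affine chart. *)
  apply: (@quadratic_zero k (cubicI s) (cubicI s * rhsI s a b c d) K inK 'X) => //.
  - exact: pcharK.
  - by rewrite polyX_eq0.
  move=> t Y; rewrite map_polyX hornerX => t0 tY.
  by rewrite -RK // infv_affv // MZ V ?mulr0 //; apply: on_curve_inf.
rewrite RK ?r10 ?r00 ?rmorph0 ?horner0 ?mul0r ?addr0 //.
rewrite rmorphM hornerM c0 !mul1r.
have -> : (map_poly inK (rhsI s a b c d)).[0] = inK d.
  rewrite /rhsI; move: (cubicI s) c0 => g g0; rewrite !rmorphD /= !linearZ /=.
  rewrite !map_polyXn map_polyX.
  by rewrite !(hornerD, hornerZ, hornerXn, hornerX) g0 !expr0n !mulr0 !add0r mulr1.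
apply: (mulfI (expf_neq0 2 n0)).
by rewrite [RHS]mulrC -E4 e4; ring.
Qed.

End GenericZero.

(** * Twists *)

Lemma vline_proportional (K : fieldType) (n : nat) (t g : 'rV[K]_n) :
  t != 0 -> g != 0 -> (forall i j, t 0 i * g 0 j = t 0 j * g 0 i) ->
  <[t]>%VS = <[g]>%VS.
Proof.
move=> t0 g0 E; have [j gj] : exists j, g 0 j != 0 by apply/rV0Pn.
have -> : t = (t 0 j / g 0 j) *: g.
  by apply/rowP => i; rewrite mxE mulrAC -E mulfK.
have l0 : t 0 j / g 0 j != 0.
  apply: contraNneq t0 => l0; apply/eqP/rowP => i; rewrite [RHS]mxE.
  by apply: (mulIf gj); rewrite E -(mulfVK gj (t 0 j)) l0 !mul0r.
by apply/eqP; rewrite eqEdim -memvE memvZ ?memv_line //= !dim_vline scaler_eq0 (negbTE l0).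
Qed.

Section Twist.
Variables (k : fieldType) (K : closedFieldType) (inK : {rmorphism k -> K}).
Variables (s u : k).

(** The map y |-> y + u, since the last coordinate is h y. *)
Definition twist_form (i : 'I_5) : {mpoly k[5]} :=
  [:: ucoord k 0; ucoord k 1; ucoord k 2; ucoord k 3;
      ucoord k 4 + u *: cubic_form s]`_i.

Definition twist (v : 'rV[K]_5) : 'rV[K]_5 := values_at inK twist_form v.

Lemma u_at_values (F : 'I_5 -> {mpoly k[5]}) (v : 'rV[K]_5) i :
  u_at (values_at inK F v) i = value_at inK (F (inord i)) v.
Proof. by rewrite /u_at mxE. Qed.

Lemma u_at_twist v i : (i < 5)%N -> u_at (twist v) i =
  [:: u_at v 0; u_at v 1; u_at v 2; u_at v 3; u_at v 4 + inK u * H_at inK s v]`_i.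
Proof.
move=> i5; rewrite u_at_values /twist_form inordK //.
case: i i5 => [|[|[|[|[|]]]]] //= _; rewrite ?value_atX //.
by rewrite value_atD value_atZ value_atX value_atH.
Qed.

Lemma H_at_twist v : H_at inK s (twist v) = H_at inK s v.
Proof. by rewrite /H_at !u_at_twist. Qed.

Lemma twistZ l v : twist (l *: v) = l *: twist v.
Proof.
have EZ (w : 'rV[K]_5) i : u_at (l *: w) i = l * u_at w i by rewrite /u_at mxE.
apply: u_at_inj => i i5; rewrite EZ !u_at_twist // /H_at !EZ.
by case: i i5 => [|[|[|[|[|]]]]] //= _; ring.
Qed.

Lemma twistK : 2%N \in [pchar k] -> involutive twist.
Proof.
move=> ch v; apply: u_at_inj => i i5; rewrite u_at_twist // H_at_twist !u_at_twist //.
case: i i5 => [|[|[|[|[|]]]]] //= _; rewrite -addrA addrr_pchar2 ?addr0 //.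
exact: rmorph_pchar ch.
Qed.

Lemma twist0 : twist 0 = 0.
Proof. by rewrite -(scale0r (0 : 'rV[K]_5)) twistZ !scale0r. Qed.

Lemma twist_eq0 v : 2%N \in [pchar k] -> (twist v == 0) = (v == 0).
Proof. by move=> ch; rewrite (inv_eq (twistK ch)) twist0. Qed.

Lemma twist_homog i : twist_form i \is 1.-homog.
Proof.
have hX j : ucoord k j \is 1.-homog by rewrite /ucoord dhomogX; apply/eqP; exact: mdeg1.
have hH : cubic_form s \is 1.-homog by rewrite /cubic_form !dhomogD ?dhomogZ.
case: i => -[|[|[|[|[|]]]]] //= lt; rewrite /twist_form /= ?hX //.
by rewrite dhomogD ?dhomogZ.
Qed.

(** Adding u to y adds u + u^2 to y^2 + y; the two equations then differ by a double. *)
Lemma on_curve_twist a b c d d' v : 2%N \in [pchar k] -> d' = d + (u + u ^+ 2) ->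
  on_curve inK s a b c d' v -> on_curve inK s a b c d (twist v).
Proof.
move=> ch -> [E1 E2 E3 E4]; split; rewrite ?H_at_twist !u_at_twist //=.
set H := H_at inK s v in E4 *.
have two : 2%:R = 0 :> K by rewrite -(rmorph_nat inK) (pcharf0 ch) rmorph0.
apply/eqP; rewrite -subr_eq0; apply/eqP.
move/eqP: E4; rewrite -subr_eq0 !rmorphD rmorphXn => /eqP E4.
apply: etrans _ E4.
rewrite -[RHS]addr0 -(mul0r (u_at v 4 * inK u * H + H ^+ 2 * (inK u + inK u ^+ 2))) -two.
by ring.
Qed.

End Twist.

Lemma value_at_homog (k : fieldType) (n : nat) (K : closedFieldType) (inK : {rmorphism k -> K})
   (e : nat) (M : {mpoly k[n]}) l (v : 'rV[K]_n) :
  M \is e.-homog -> value_at inK M (l *: v) = l ^+ e * value_at inK M v.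
Proof.
move=> hM; rewrite !value_at_mmap -mmap_homog //; apply: eq_mmap => // i.
by rewrite mxE.
Qed.

Lemma curve_on_curve (k : fieldType) (K : closedFieldType) (inK : {rmorphism k -> K})
  (s a b c d : k) v : v != 0 ->
  curve inK s a b c d <[v]>%VS <-> on_curve inK s a b c d v.
Proof. exact: curve_vectP. Qed.

Section TwistIsomorphism.
Variables (k : fieldType) (K : closedFieldType) (inK : {rmorphism k -> K}).
Hypothesis ch : 2%N \in [pchar k].

Lemma twist_k_morphism (s a b c d d' u : k) (phi : {vspace 'rV[K]_5} -> {vspace 'rV[K]_5}) :
  d' = d + (u + u ^+ 2) ->
  (forall v, v != 0 -> on_curve inK s a b c d' v ->
     phi <[v]>%VS = <[twist inK s u v]>%VS) ->
  k_morphism inK (curve inK s a b c d') (curve inK s a b c d) phi.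
Proof.
move=> Ed Ephi; have tw0 v : v != 0 -> twist inK s u v != 0 by rewrite twist_eq0.
split=> P XP; have [v v0 EP] := dim1_vline XP.1; rewrite {}EP in XP *.
  rewrite Ephi //; last exact/curve_on_curve.
  by apply/curve_on_curve; [exact: tw0|apply: on_curve_twist Ed _ => //; apply/curve_on_curve].
exists 1%N, (twist_form s u); split=> [i|w _|Q w XQ wQ w0 _].
- exact: twist_homog.
- exact: tw0.
have EQ : Q = <[w]>%VS.
  by apply/esym/eqP; rewrite eqEdim -memvE wQ dim_vline w0 XQ.1.
by rewrite EQ Ephi //; apply/curve_on_curve; rewrite -?EQ.
Qed.

Variables (s a b c d d' u : k).
Hypothesis Ed : d' = d + (u + u ^+ 2).

Definition twist_map (P : {vspace 'rV[K]_5}) := <[twist inK s u (vpick P)]>%VS.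

Lemma twist_mapE v : v != 0 -> twist_map <[v]>%VS = <[twist inK s u v]>%VS.
Proof.
move=> v0; have /vlineP[l El] : vpick <[v]>%VS \in <[v]>%VS by apply: memv_pick.
have l0 : l != 0.
  have : vpick <[v]>%VS != 0 by rewrite vpick0 -dimv_eq0 dim_vline v0.
  by apply: contraNneq => l0; rewrite El l0 scale0r.
rewrite /twist_map El twistZ; apply/eqP; rewrite eqEdim -memvE memvZ ?memv_line //=.
by rewrite !dim_vline scaler_eq0 (negbTE l0).
Qed.

(** The inverse is the twist by the same u, as 2u = 0. Only the values of [phi] on the curve are
    prescribed. *)
Lemma twist_k_isomorphism (phi : {vspace 'rV[K]_5} -> {vspace 'rV[K]_5}) :
  (forall v, v != 0 -> on_curve inK s a b c d' v ->
     phi <[v]>%VS = <[twist inK s u v]>%VS) ->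
  k_isomorphism inK (curve inK s a b c d') (curve inK s a b c d) phi.
Proof.
move=> Ephi; split; first exact: twist_k_morphism Ed Ephi.
have Ed' : d = d' + (u + u ^+ 2).
  by rewrite Ed -addrA addrr_pchar2 ?addr0.
exists twist_map; split.
- by apply: (twist_k_morphism Ed') => v v0 _; apply: twist_mapE.
- move=> P XP; have [v v0 EP] := dim1_vline XP.1; rewrite {}EP in XP *.
  rewrite Ephi //; last exact/curve_on_curve.
  by rewrite twist_mapE ?twist_eq0 // twistK.
move=> P XP; have [v v0 EP] := dim1_vline XP.1; rewrite {}EP in XP *.
rewrite twist_mapE // Ephi ?twist_eq0 ?twistK //.
by apply: (on_curve_twist ch Ed'); apply/curve_on_curve.
Qed.

End TwistIsomorphism.

(** * Isomorphisms at the generic point *)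

(** Modulo h there remains a x^2 + b x + c, which is nonzero and of smaller degree than h. *)
Lemma rhs_ndvd (k : fieldType) (s a b c d : k) :
  (a, b, c) <> (0, 0, 0) -> ~~ (cubic s %| rhs s a b c d).
Proof.
move=> abc; rewrite /rhs dvdp_addl; last by rewrite -mul_polyC dvdp_mull.
set n := _ + c%:P; have coefn i : n`_i = [:: c; b; a]`_i.
  rewrite !(coefD, coefZ, coefXn, coefX, coefC).
  by case: i => [|[|[|i]]] /=; rewrite ?mulr0 ?mulr1 ?addr0 ?add0r ?nth_nil.
have sn : (size n <= 3)%N.
  by apply/leq_sizeP => i i3; rewrite coefn nth_default.
have n0 : n != 0.
  apply: contra_notN abc => /eqP n0.
  by have := coefn 0; have := coefn 1; have := coefn 2; rewrite n0 !coef0 /= => <- <- <-.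
by apply/negP => /(dvdp_leq n0); rewrite size_cubic leqNgt ltnS sn.
Qed.

Lemma size_rhs (k : fieldType) (s a b c d : k) : (size (rhs s a b c d) <= 4)%N.
Proof.
apply/leq_sizeP => i i4; rewrite /rhs /cubic !(coefD, coefZ, coefXn, coefX, coefC).
by case: i i4 => [|[|[|[|i]]]] //= _; rewrite !(mulr0, addr0).
Qed.

Section GenericIsomorphism.
Variables (k : fieldType) (K : closedFieldType) (inK : {rmorphism k -> K}).
Hypothesis ch : 2%N \in [pchar k].
Variables (F : fieldType) (toF : {rmorphism {poly k} -> F}).
Hypothesis toF_inj : injective toF.
Hypothesis toF_frac : forall P, exists u w,
  [/\ w != 0, coprimep u w & P = toF u / toF w].
Variables (E : fieldType) (inE : {rmorphism F -> E}).
Local Notation ev := (inE \o toF).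
Local Notation evC := (inE \o toF \o polyC).
Variables (s a b c d a' b' c' d' : k) (y : E).
Local Notation h := (cubic s).
Local Notation m := (rhs s a b c d).
Local Notation m' := (rhs s a' b' c' d').
Hypothesis irr : irreducible_poly h.
Hypothesis abc : (a, b, c) <> (0, 0, 0).
Hypothesis abc' : (a', b', c') <> (0, 0, 0).
Hypothesis Ey : ev h * (y ^+ 2 + y) = ev m'.
Hypothesis basis : forall e : E, exists A B : F, e = inE A + inE B * y.
Hypothesis noaut : forall u w : {poly k}, (size u <= 2)%N -> (size w <= 2)%N ->
  w != 0 -> h %| hom3 h u w -> u = 'X * w.
Variable phi : {vspace 'rV[K]_5} -> {vspace 'rV[K]_5}.
Local Notation X := (curve inK s a b c d).
Local Notation X' := (curve inK s a' b' c' d').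
Local Notation on := (on_curve inK s a b c d).
Local Notation on' := (on_curve inK s a' b' c' d').
Hypothesis iso : k_isomorphism inK X' X phi.
Local Notation xi := (generic_coord toF inE s y).
Local Notation gen M := (mmap evC xi M).

Let nhm : ~~ (h %| m). Proof. exact: rhs_ndvd. Qed.
Let nhm' : ~~ (h %| m'). Proof. exact: rhs_ndvd. Qed.

Lemma gen_eq0 (M : {mpoly k[5]}) :
  (forall v, v != 0 -> on' v -> value_at inK M v = 0) -> gen M = 0.
Proof.
move=> V; apply/(generic_zeroP inK ch toF_inj toF_frac irr nhm' Ey) => x Y XY.
by apply: V => //; apply: affv_neq0.
Qed.

Lemma gen_neq0 (M : {mpoly k[5]}) e v :
  (forall l w, value_at inK M (l *: w) = l ^+ e * value_at inK M w) ->
  v != 0 -> on' v -> value_at inK M v != 0 -> gen M != 0.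
Proof.
move=> MZ v0 Cv; apply: contraNneq => M0.
by rewrite (generic_zero_all (inK := inK) ch toF_inj toF_frac irr nhm' Ey MZ M0).
Qed.

Lemma genX i : gen 'X_i = xi i.
Proof. by rewrite mmapX mmap1U. Qed.

Lemma value_atXE (v : 'rV[K]_5) i : value_at inK 'X_i v = v 0 i.
Proof. by rewrite value_at_mmap mmapX mmap1U. Qed.

Definition local_form e (F1 : 'I_5 -> {mpoly k[5]}) : Prop :=
  (forall i, F1 i \is e.-homog) /\
  (forall v, v != 0 -> on' v -> values_at inK F1 v != 0 ->
     phi <[v]>%VS = <[values_at inK F1 v]>%VS).

Lemma local_forms v : v != 0 -> on' v ->
  exists e F1, local_form e F1 /\ values_at inK F1 v != 0.
Proof.
move=> v0 Cv; have [[_ phiF] _] := iso.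
have XP : X' <[v]>%VS by apply/curve_on_curve.
have [e [F1 [Fh Fv FX]]] := phiF _ XP.
exists e, F1; split; last by apply: Fv => //; apply: memv_line.
split=> // w w0 Cw Fw; apply: FX => //; first exact/curve_on_curve.
exact: memv_line.
Qed.

Lemma on_curve0 : on 0.
Proof.
by rewrite -(scale0r (affv 0 0 : 'rV[K]_5)); split;
   rewrite /H_at /u_at !mxE; ring.
Qed.

Lemma local_form_on e F1 v : local_form e F1 -> v != 0 -> on' v ->
  on (values_at inK F1 v).
Proof.
move=> [_ FX] v0 Cv; have [->|Fv] := eqVneq (values_at inK F1 v) 0.
  exact: on_curve0.
apply/(curve_on_curve inK _ _ _ _ _ Fv); rewrite -FX //.
by have [[phiX _] _] := iso; apply: phiX; apply/curve_on_curve.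
Qed.

(** Where both tuples are nonzero they span the same line; elsewhere both products are zero. So the
    minors vanish on the curve, and therefore at the generic point. *)
Lemma local_form_agree e1 F1 e2 F2 i j : local_form e1 F1 -> local_form e2 F2 ->
  gen (F1 i) * gen (F2 j) = gen (F1 j) * gen (F2 i).
Proof.
move=> [_ FX1] [_ FX2]; apply/eqP; rewrite -subr_eq0 -!rmorphM -rmorphB; apply/eqP.
apply: gen_eq0 => v v0 Cv.
rewrite value_atD value_atN !value_atM.
have E1 l : value_at inK (F1 l) v = values_at inK F1 v 0 l by rewrite mxE.
have E2 l : value_at inK (F2 l) v = values_at inK F2 v 0 l by rewrite mxE.
rewrite !E1 !E2; have [->|n1] := eqVneq (values_at inK F1 v) 0.
  by rewrite !mxE !mul0r subrr.
have [->|n2] := eqVneq (values_at inK F2 v) 0.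
  by rewrite !mxE !mulr0 subrr.
have [l _ ->] := vline_eq n1 (etrans (esym (FX1 v v0 Cv n1)) (FX2 v v0 Cv n2)).
by move: (values_at inK F2 v) => g; rewrite !mxE; ring.
Qed.

(** Forms for [phi] at the generic point give G and W, forms for its inverse composed with them give
    [Ex] and [EY], and [generic_isomorphism] yields u; agreement with the twist spreads from the
    generic point to all points. *)
Lemma isomorphism_twist : exists u, m - m' = (u ^+ 2 + u)%:P * h /\
  forall v, v != 0 -> on' v -> phi <[v]>%VS = <[twist inK s u v]>%VS.
Proof.
have [[phiX _] [psi [[psiX psiF] psiphi phipsi]]] := iso.
(* In characteristic two h(1) = 1, so a point with x = 1 lies in the quasi-affine model. Forms F0
   that are nonzero at its preimage therefore make [Phi 3] and [PhiH] nonzero. *)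
have h1 : (map_poly inK h).[1] = 1.
  rewrite -/(h_at _ _ _) h_atE expr1n mulr1 -addrA addrr_pchar2 ?addr0 //.
  exact: rmorph_pchar ch.
have [Y0 EY0] := closed_quadratic (map_poly inK h).[1] (map_poly inK (h * m)).[1].
pose q0 := affv 1 Y0; have q0n : q0 != 0 by apply: affv_neq0.
have Cq : on q0 by apply/on_curve_aff.
have XQ : X <[q0]>%VS by apply/curve_on_curve.
have [v0 v0n EP0] := dim1_vline (psiX _ XQ).1.
have Cv0 : on' v0 by apply/(curve_on_curve inK _ _ _ _ _ v0n); rewrite -EP0; apply: psiX.
have [e [F0 [LF F0v]]] := local_forms v0n Cv0.
have [l l0 El] : exists2 l, l != 0 & values_at inK F0 v0 = l *: q0.
  by apply: vline_eq => //; rewrite -LF.2 // -EP0 phipsi.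
have [e' [F' [F'h F'q F'X]]] := psiF _ XQ.
have FZ i w c0 : value_at inK (F0 i) (c0 *: w) = c0 ^+ e * value_at inK (F0 i) w.
  by apply: value_at_homog; apply: LF.1.
pose f i := F0 (inord i); pose Phi i := gen (f i).
have fE i v : value_at inK (f i) v = u_at (values_at inK F0 v) i.
  by rewrite u_at_values.
have Phi3 : Phi 3 != 0.
  apply: (gen_neq0 (e := e) (v := v0)) => //; first by move=> c0 w; apply: FZ.
  by rewrite fE El /u_at mxE -/(u_at _ _) u_at_aff //= mulr1.
pose PhiH := Phi 0 + evC s * Phi 2 + evC s * Phi 3.
have [fH [fHE fHZ genfH]] : exists fH : {mpoly k[5]},
    [/\ forall v, value_at inK fH v = H_at inK s (values_at inK F0 v),
        forall c0 w, value_at inK fH (c0 *: w) = c0 ^+ e * value_at inK fH w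
      & gen fH = PhiH].
  exists (f 0 + s *: f 2 + s *: f 3); split=> [v|c0 w|].
  - by rewrite !(value_atD, value_atZ) !fE.
  - by rewrite !(value_atD, value_atZ) !FZ !mulrDr ![inK s * (_ * _)]mulrCA.
  by rewrite !rmorphD /= !mmapZ.
have PhiH0 : PhiH != 0.
  rewrite -genfH; apply: (gen_neq0 (e := e) (v := v0)) => //.
  rewrite fHE El /H_at; have EZ i : u_at (l *: q0) i = l * u_at q0 i by rewrite /u_at mxE.
  rewrite !EZ [X in X != 0](_ : _ = l * H_at inK s q0); last by rewrite /H_at; ring.
  by rewrite H_at_aff h1 mulr1.
(* The equations of the target hold at the image of every point, hence at the image of the generic
   point. *)
have [R1 R2 R3 R4] : [/\ Phi 0 * Phi 2 = Phi 1 ^+ 2, Phi 0 * Phi 3 = Phi 1 * Phi 2,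
    Phi 1 * Phi 3 = Phi 2 ^+ 2 & Phi 4 ^+ 2 + PhiH * Phi 4 =
      PhiH * (evC a * Phi 1 + evC b * Phi 2 + evC c * Phi 3) + evC d * PhiH ^+ 2].
  have Z (M N : {mpoly k[5]}) : (forall v, v != 0 -> on' v ->
      value_at inK M v = value_at inK N v) -> gen M = gen N.
    move=> MN; apply/eqP; rewrite -subr_eq0 -rmorphB; apply/eqP/gen_eq0 => v vn Cv.
    by rewrite value_atD value_atN MN // subrr.
  split.
  - rewrite -rmorphM -rmorphXn; apply: Z => v vn Cv; rewrite expr2 !value_atM !fE.
    by have [-> _ _ _] := local_form_on LF vn Cv; rewrite expr2.
  - rewrite -!rmorphM; apply: Z => v vn Cv; rewrite !value_atM !fE.
    by have [_ -> _ _] := local_form_on LF vn Cv.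
  - rewrite -rmorphM -rmorphXn; apply: Z => v vn Cv; rewrite expr2 !value_atM !fE.
    by have [_ _ -> _] := local_form_on LF vn Cv; rewrite expr2.
  have EM : gen (f 4 ^+ 2 + fH * f 4) = gen (fH * (a *: f 1 + b *: f 2 + c *: f 3) + d *: fH ^+ 2).
    apply: Z => v vn Cv; rewrite !(value_atD, value_atM, value_atZ, expr2) !fHE !fE.
    by have [_ _ _] := local_form_on LF vn Cv; rewrite !expr2.
  move: EM; rewrite !rmorphD rmorphXn !rmorphM !rmorphD /= !mmapZ.
  by rewrite (rmorphXn (mmap evC xi)) /= genfH.
(* The coordinates x and y of the image of the generic point. *)
pose G := Phi 2 / Phi 3; pose W := Phi 4 / PhiH.
pose hG := (map_poly evC h).[G].
have e2 : Phi 2 = Phi 3 * G by rewrite /G mulrC mulfVK.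
have e1 : Phi 1 = Phi 3 * G ^+ 2 by apply: (mulIf Phi3); rewrite R3 e2; ring.
have e0 : Phi 0 = Phi 3 * G ^+ 3 by apply: (mulIf Phi3); rewrite R2 e2 e1; ring.
have hGE : hG = G ^+ 3 + evC s * G + evC s.
  by rewrite /hG /cubic !rmorphD /= map_polyXn linearZ /= map_polyX map_polyC !hornerE.
have eH : PhiH = Phi 3 * hG by rewrite /PhiH e0 e2 hGE; ring.
have hG0 : hG != 0 by apply: contraNneq PhiH0 => E0; rewrite eH E0 mulr0.
have e4 : Phi 4 = Phi 3 * (hG * W) by rewrite /W eH; field; rewrite hG0 Phi3.
have EW : hG * (W ^+ 2 + W) = (map_poly evC m).[G].
  rewrite rhs_at -/hG.
  have nn : Phi 3 ^+ 2 * hG != 0 by rewrite mulf_neq0 // expf_neq0.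
  apply: (mulIf nn); apply: (@etrans _ _ (Phi 4 ^+ 2 + PhiH * Phi 4)).
    by rewrite e4 eH; ring.
  by rewrite R4 eH e1 e2; ring.
clearbody W.
have PhiE i : gen (F0 i) = Phi 3 * aff_coord G (hG * W) i.
  have -> : gen (F0 i) = Phi i by rewrite /Phi /f inord_val.
  by case: i => -[|[|[|[|[|]]]]] //= lt; rewrite /aff_coord /= mulr1.
(* [Psi] is the inverse applied to the image of the generic point; [cmp] is the composite form over
   k, through which statements about points reach [Psi]. *)
pose Psi i := mmap evC (fun j => gen (F0 j)) (F' i).
pose cmp i : {mpoly k[5]} := mmap (@mpolyC 5 k) F0 (F' i).
have gen_cmp i : gen (cmp i) = Psi i.
  rewrite /cmp (rmorph_mmap (@mpolyC 5 k) (mmap evC xi)); apply: eq_mmap => // r.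
  exact: mmapC.
have val_cmp i v : value_at inK (cmp i) v = value_at inK (F' i) (values_at inK F0 v).
  rewrite value_at_mmap /cmp (rmorph_mmap (@mpolyC 5 k) (mmap inK (v 0))) value_at_mmap.
  apply: eq_mmap => [r|j] /=; first exact: mmapC.
  by rewrite mxE value_at_mmap.
have F0Z v c0 : values_at inK F0 (c0 *: v) = c0 ^+ e *: values_at inK F0 v.
  by apply/rowP => i; rewrite !mxE FZ.
have cmpZ i c0 v : value_at inK (cmp i) (c0 *: v) = c0 ^+ (e * e') * value_at inK (cmp i) v.
  by rewrite !val_cmp F0Z (value_at_homog _ _ _ (F'h i)) exprM.
(* The identity psi (phi v) = v makes the composite forms proportional to the coordinates of v. *)
have minor i j : Psi i * xi j = Psi j * xi i.
  apply: (mulfI Phi3); apply/eqP; rewrite -subr_eq0 -!gen_cmp -!genX.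
  rewrite -!rmorphM -rmorphB; apply/eqP/gen_eq0 => v vn Cv.
  rewrite value_atD value_atN !value_atM !val_cmp !value_atXE fE.
  have [->|Fv] := eqVneq (values_at inK F0 v) 0.
    by rewrite /u_at mxE !mul0r subrr.
  set g := values_at inK F0 v in Fv *.
  have Ei r : value_at inK (F' r) g = values_at inK F' g 0 r by rewrite mxE.
  rewrite !Ei; have [->|F'v] := eqVneq (values_at inK F' g) 0.
    by rewrite !mxE !mul0r !mulr0 subrr.
  have Xv : X' <[v]>%VS by apply/curve_on_curve.
  have Ev : <[v]>%VS = <[values_at inK F' g]>%VS.
    rewrite -[LHS](psiphi _ Xv) LF.2 //.
    have Xg : X <[g]>%VS.
      by apply/(curve_on_curve inK _ _ _ _ _ Fv); apply: local_form_on LF vn Cv.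
    exact: F'X Xg (memv_line g) Fv F'v.
  have [r _ ->] := vline_eq vn Ev; move: (values_at inK F' g) => g'.
  by rewrite !mxE; ring.
have xi3 : xi (inord 3) = 1 by rewrite /generic_coord /aff_coord inordK.
have PsiE i : Psi i = Psi (inord 3) * xi i by rewrite -minor xi3 mulr1.
have Psi3 : Psi (inord 3) != 0.
  have /rV0Pn[i Fi] : values_at inK F' (values_at inK F0 v0) != 0.
    apply: F'q; last exact: F0v.
    by rewrite El memvZ // memv_line.
  have : Psi i != 0.
    rewrite -gen_cmp; apply: (gen_neq0 (cmpZ i) v0n Cv0).
    by rewrite val_cmp; move: Fi; rewrite mxE.
  by rewrite PsiE mulf_eq0 negb_or => /andP[].
(* Reduction modulo the equation of the target at Y = h(G) W; homogeneity extracts the power of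
   [Phi 3]. *)
have red i : exists r1 r0 : {poly k}, Psi i = Phi 3 ^+ e' *
    ((map_poly evC r0).[G] + (map_poly evC (r1 * h)).[G] * W).
  have [r1 [r0 R]] := aff_reduction h (h * m) (F' i).
  exists r1, r0.
  pose g : {rmorphism {poly k} -> E} := horner_eval G \o map_poly evC.
  have rel : (hG * W) ^+ 2 + g h * (hG * W) = g (h * m).
    have -> : g (h * m) = g h * g m by rewrite rmorphM.
    by rewrite /= /horner_eval -/hG -EW; ring.
  have := R E g _ rel; rewrite /= {2 3}/horner_eval => Rg.
  have -> : Psi i = Phi 3 ^+ e' * mmap evC (aff_coord G (hG * W)) (F' i).
    rewrite /Psi -mmap_homog //; apply: eq_mmap => // j; exact: PhiE.
  congr (_ * _); rewrite rmorphM hornerM -/hG -mulrA -Rg; apply: eq_mmap => [r|j].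
    by rewrite /= /horner_eval map_polyC hornerC.
  by rewrite /horner_eval map_polyX hornerX.
have [b3 [a3 E3]] := red (inord 3).
have [b2 [a2 E2]] := red (inord 2).
have [b4 [a4 E4]] := red (inord 4).
have Phi3e : Phi 3 ^+ e' != 0 by rewrite expf_neq0.
have mu0 : (map_poly evC a3).[G] + (map_poly evC (b3 * h)).[G] * W != 0.
  by apply: contraNneq Psi3 => E0; rewrite E3 E0 mulr0.
have chE : 2%N \in [pchar E].
  by apply: (rmorph_pchar inE); apply: (rmorph_pchar toF); apply: (rmorph_pchar polyC).
have Ex : ((map_poly evC a3).[G] + (map_poly evC (b3 * h)).[G] * W) * ev 'X =
    (map_poly evC a2).[G] + (map_poly evC (b2 * h)).[G] * W.
  apply: (mulfI Phi3e); rewrite mulrA -E3 -E2 [RHS]PsiE.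
  by rewrite /generic_coord /aff_coord inordK.
have EY : ((map_poly evC a3).[G] + (map_poly evC (b3 * h)).[G] * W) * (ev h * y) =
    (map_poly evC a4).[G] + (map_poly evC (b4 * h)).[G] * W.
  apply: (mulfI Phi3e); rewrite mulrA -E3 -E4 [RHS]PsiE.
  by rewrite /generic_coord /aff_coord inordK.
have [GX [u [Wu Em]]] := generic_isomorphism inK toF_inj toF_frac irr (size_cubic s) chE
  nhm nhm' Ey basis hG0 EW mu0 Ex EY noaut (size_rhs s a b c d) (size_rhs s a' b' c' d').
exists u; split=> // v vn Cv.
have hGh : hG = ev h by rewrite /hG GX ev_X.
(* At the generic point the twist by u has the affine coordinates of the image (G, W). *)
have twE i : gen (twist_form s u i) = aff_coord G (hG * W) i.
  have gu j : (j < 5)%N -> gen (ucoord k j) = [:: G ^+ 3; G ^+ 2; G; 1; hG * y]`_j.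
    by move=> j5; rewrite genX /generic_coord /aff_coord inordK // GX hGh.
  case: i => -[|[|[|[|[|]]]]] //= lt; rewrite /twist_form /aff_coord /= ?gu //.
  rewrite rmorphD /= mmapZ /cubic_form !rmorphD /= !mmapZ !gu //= mulr1 -hGE Wu.
  by rewrite /=; ring.
(* F0 may vanish at v, so other forms F5 are taken there; they agree with F0, hence with the twist,
   at the generic point, and the vanishing of the minors passes to all points. *)
have [e5 [F5 [LF5 F5v]]] := local_forms vn Cv.
rewrite (LF5.2 v vn Cv F5v); apply/esym/vline_proportional => [||i j].
- by rewrite twist_eq0.
- exact: F5v.
rewrite !mxE; apply/eqP; rewrite -subr_eq0 -!value_atM -value_atN -value_atD; apply/eqP.
apply: (generic_zero_all (inK := inK) ch toF_inj toF_frac irr nhm' Ey (e := (1 + e5)%N)) => //.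
  move=> c0 w; rewrite !(value_atD, value_atN, value_atM) !(value_at_homog _ _ _ (LF5.1 _)).
  rewrite !(value_at_homog _ _ _ (twist_homog _ _ _)) exprD.
  move: (value_at inK (twist_form s u i) w) (value_at inK (twist_form s u j) w).
  by move: (value_at inK (F5 i) w) (value_at inK (F5 j) w) => g1 g2 t1 t2; ring.
rewrite rmorphB !rmorphM /= !twE; apply: (mulfI Phi3).
by rewrite mulr0 mulrBr !mulrA -!PhiE (local_form_agree i j LF LF5) subrr.
Qed.

End GenericIsomorphism.

(** * Coefficients of isomorphic curves and cosets of AS(k) *)

(** The function field of the source is the Artin-Schreier extension of k(x) by m'/h, of degree two
    because m'/h is not of the form t^2 + t. *)
Lemma curve_isomorphism_twist (k : fieldType) (K : closedFieldType)
    (inK : {rmorphism k -> K}) (s a b c d a' b' c' d' : k)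
    (phi : {vspace 'rV[K]_5} -> {vspace 'rV[K]_5}) :
  2%N \in [pchar k] -> irreducible_poly (cubic s) ->
  (a, b, c) <> (0, 0, 0) -> (a', b', c') <> (0, 0, 0) ->
  (forall u w : {poly k}, (size u <= 2)%N -> (size w <= 2)%N ->
     w != 0 -> cubic s %| hom3 (cubic s) u w -> u = 'X * w) ->
  k_isomorphism inK (curve inK s a' b' c' d') (curve inK s a b c d) phi ->
  exists u, [/\ (a', b', c') = (a, b, c), d' = d + (u + u ^+ 2) &
    forall v, v != 0 -> on_curve inK s a' b' c' d' v ->
      phi <[v]>%VS = <[twist inK s u v]>%VS].
Proof.
move=> ch irr abc abc' noaut iso.
pose toF : {rmorphism {poly k} -> {fraction {poly k}}} := @FracField.tofrac {poly k}.
have tinj : injective toF by apply: tofrac_inj.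
have tfrac : forall P, exists u w, [/\ w != 0, coprimep u w & P = toF u / toF w].
  exact: frac_coprime.
have h0 : toF (cubic s) != 0 by rewrite toF_eq0 // irredp_neq0.
have noroot t : t ^+ 2 + t <> toF (rhs s a' b' c' d') / toF (cubic s).
  move=> Et; apply: (AS_noroot tinj tfrac irr (rhs_ndvd s d' abc') (P := t)).
  by rewrite Et mulrC mulfVK.
have [E [inE [y [Ey basis]]]] := quadratic_extension noroot.
have Ey' : (inE \o toF) (cubic s) * (y ^+ 2 + y) = (inE \o toF) (rhs s a' b' c' d').
  by rewrite Ey /= -(rmorphM inE) mulrC mulfVK.
have [u [Em Ephi]] := isomorphism_twist ch tinj tfrac irr abc abc' Ey' basis noaut iso.
(* As h has no x^2 term, x^2 gives a' = a; x^3 gives d - d' = u^2 + u, and then x and 1 give b' = b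
   and c' = c. *)
have ci i := congr1 (fun p : {poly k} => p`_i) Em.
have := ci 3; have := ci 2; have := ci 1%N; have := ci 0.
rewrite /rhs /cubic !(coefN, coefD, coefZ, coefXn, coefX, coefC, coefCM) /=.
rewrite !(mulr0, mulr1, add0r, addr0) => E0 E1 E2 E3.
have eq_of (x z : k) : x - z = 0 -> z = x by move/eqP; rewrite subr_eq0 => /eqP ->.
have aa : a' = a by apply: eq_of; rewrite E2.
have bb : b' = b.
  apply: eq_of.
  have -> : b - b' = b + d * s - (b' + d' * s) - (d - d') * s by ring.
  by rewrite E1 E3 subrr.
have cc : c' = c.
  apply: eq_of.
  have -> : c - c' = c + d * s - (c' + d' * s) - (d - d') * s by ring.
  by rewrite E0 E3 subrr.
exists u; split=> //; first by rewrite aa bb cc.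
have {1}-> : d' = d - (d - d') by ring.
by rewrite E3 (oppr_pchar2 ch) [u + _]addrC.
Qed.

(** In characteristic two x + x^2 is additive, so a coset may be based at any of its elements. *)
Lemma AS_coset (k : fieldType) (D : set k) (d : k) : 2%N \in [pchar k] ->
  AS_quotient D -> D d -> D = [set d + u | u in @AS k].
Proof.
move=> ch [d0 _ <-] [_ [v _ <-] <-].
have two : 2%:R = 0 :> k by apply: pcharf0.
apply/seteqP; split=> _ [_ [w _ <-] <-].
  exists ((w + v) + (w + v) ^+ 2); first by exists (w + v).
  apply/eqP; rewrite -subr_eq0; apply/eqP.
  by rewrite -(mul0r (v + v ^+ 2 + w * v)) -two; ring.
exists ((v + w) + (v + w) ^+ 2); first by exists (v + w).
apply/eqP; rewrite -subr_eq0; apply/eqP.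
by rewrite -(mul0r (w * v)) -two; ring.
Qed.

Lemma hyperelliptic_twist (k : fieldType) (K : closedFieldType)
    (inK : {rmorphism k -> K}) (s : k) :
  hyperelliptic inK s = twist_map inK s 1.
Proof.
apply: funext => P; rewrite /hyperelliptic /twist_map /twist.
by rewrite /twist_form scale1r.
Qed.

Lemma iter_hyperelliptic (k : fieldType) (K : closedFieldType)
    (inK : {rmorphism k -> K}) (s : k) m v : 2%N \in [pchar k] -> v != 0 ->
  iter m (hyperelliptic inK s) <[v]>%VS = <[twist inK s (odd m)%:R v]>%VS.
Proof.
move=> ch v0; rewrite hyperelliptic_twist.
have tw0 w : twist inK s 0 w = w.
  apply: u_at_inj => i i5; rewrite u_at_twist // rmorph0 mul0r addr0.
  by case: i i5 => [|[|[|[|[|]]]]].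
elim: m => [|m IH]; first by rewrite /= tw0.
rewrite iterS IH twist_mapE ?twist_eq0 //=.
by case: (odd m); rewrite /= tw0 ?twistK.
Qed.

Theorem proposition10
  (k : fieldType) (hchar : 2%N \in [pchar k]) (hperf : perfect_field k)
  (s : k) (hirr : irreducible_poly (cubic s))
  (L : splittingFieldType k) (z : L)
  (hz : root (map_poly (in_alg L) (cubic s)) z)
  (hcyc : ~~ cyclic_extension 1%AS <<1%AS; z>>%AS)
  (K : closedFieldType) (inK : {rmorphism k -> K})
  (hK : algebraic_closure inK) :
  (forall (a b c a' b' c' : k) (D D' : set k),
     calN (a, b, c, D) -> calN (a', b', c', D') ->
     forall d d' : k, D d -> D' d' ->
       (k_isomorphic inK (curve inK s a' b' c' d') (curve inK s a b c d) <->
        (a', b', c', D') = (a, b, c, D)))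
  /\
  (forall (a b c : k) (D : set k),
     calN (a, b, c, D) ->
     forall d : k, D d ->
     forall phi : {vspace 'rV[K]_5} -> {vspace 'rV[K]_5},
       k_automorphism inK (curve inK s a b c d) phi <->
       exists m : nat, forall P, curve inK s a b c d P ->
         phi P = iter m (hyperelliptic inK s) P).
Proof.
have noaut := cubic_noaut hperf hirr hz hcyc.
split=> [a b c a' b' c' D D' [abc QD] [abc' QD'] d d' Dd Dd'|a b c D [abc QD] d Dd phi].
  rewrite /= in abc abc' QD QD'.
  split=> [[phi iso]|[-> -> -> ED]].
    have [u [-> Ed _]] := curve_isomorphism_twist hchar hirr abc abc' noaut iso.
    congr (_, _); rewrite (AS_coset hchar QD' Dd'); apply/esym/AS_coset => //.
    by rewrite (AS_coset hchar QD Dd) Ed; exists (u + u ^+ 2) => //; exists u.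
  rewrite (AS_coset hchar QD Dd) in ED.
  (* Equality of the cosets gives d' = d + u + u^2 for some u, and the twist by u is the
     isomorphism. *)
  have : D' d' by [].
  rewrite ED => -[_ [u _ <-] Ed'].
  exists (twist_map inK s u); apply: (twist_k_isomorphism hchar (esym Ed')) => v v0 _.
  exact: twist_mapE.
rewrite /= in abc QD.
split=> [iso|[m Em]].
  have [u [_ Ed Ephi]] := curve_isomorphism_twist hchar hirr abc abc noaut iso.
  have [m Eu] : exists m : nat, u = (odd m)%:R.
    (* Source and target share d, so u + u^2 = 0 and u is 0 or 1. *)
    have : u * (1 + u) = 0 by apply: (addrI d); rewrite addr0 [RHS]Ed; ring.
    move/eqP; rewrite mulf_eq0 addr_eq0 => /orP[/eqP ->|/eqP u1]; first by exists 0%N.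
    by exists 1%N; rewrite /= u1 (oppr_pchar2 hchar).
  exists m => P XP; have [v v0 EP] := dim1_vline XP.1; rewrite {}EP in XP *.
  by rewrite Ephi ?iter_hyperelliptic ?Eu //; apply/curve_on_curve.
apply: (@twist_k_isomorphism _ _ _ hchar _ _ _ _ _ _ (odd m)%:R) => [|v v0 Cv].
  by case: (odd m); rewrite /= ?expr1n ?expr0n ?addr0 // addrr_pchar2 ?addr0.
rewrite Em ?iter_hyperelliptic //; exact/curve_on_curve.
Qed.
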